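(* Let $n\ge2$, let $I\subseteq(0,+\infty)$ be an open interval, $\Omega=\tau^{-1}(I)\subset\mathbb{H}^n$, and let $\Gamma:\Omega\to\mathbb{H}^n\times_{-1}\mathbb{R}$, $\Gamma(p)=(p,u(p))$, with $u\in C^2(\Omega)$ constant on the level sets of $\tau$, be a rotationally symmetric space-like translator. Then there exists $f:(0,+\infty)\to\mathbb{R}$ solving $$f''(s)=\left(1-f'(s)^2\right)\left(1-(n-1)\coth(s)f'(s)\right),\qquad s\in(0,+\infty),$$ such that $\Gamma(p)=(p,f(\tau(p)))$ for all $p\in\Omega$. There are three types of such functions $f=\int w$ (with $w=f'$): the bowl ($w=\hat w$), those with $\lim_{s\to0}w(s)=1$, and those with $\lim_{s\to0}w(s)=-1$.
   Context: $\mathbb{H}^n=\{p\in\mathbb{L}^{n+1}:\langle p,p\rangle_L=-1,\ p_{n+1}>0\}$, where $\mathbb{L}^{n+1}=\mathbb{R}^{n+1}$ with $\langle x,y\rangle_L=x_1y_1+\dots+x_ny_n-x_{n+1}y_{n+1}$; $g_{\mathbb{H}^n}$ is the induced metric. $\mathbb{H}^n\times_{-1}\mathbb{R}$ is $\mathbb{H}^n\times\mathbb{R}$ with the Lorentzian metric $g_{\mathbb{H}^n}-dt^2$. The function $\tau(p)=\ln\left(\sqrt{p_{n+1}^2-1}+p_{n+1}\right)=\operatorname{arccosh}(p_{n+1})$ is the hyperbolic distance to $(0,\dots,0,1)$; its positive level sets are the $SO(n)$-orbits. For $u\in C^2(\Omega)$, the graph $\Gamma_u(p)=(p,u(p))$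 is space-like if $|\nabla u|<1$ on $\Omega$ (gradient, norm and divergence with respect to $g_{\mathbb{H}^n}$). A space-like graph is a translator if its mean curvature vector (trace of the second fundamental form) equals $\partial_t^\perp$, equivalently $$\mathrm{div}\left(\frac{\nabla u}{\sqrt{1-|\nabla u|^2}}\right)=\frac{1}{\sqrt{1-|\nabla u|^2}}.$$ $\hat w:[0,+\infty)\to(-1,1)$ denotes the unique continuous function with $\hat w(0)=0$ that solves $w'(s)=(1-w(s)^2)(1-(n-1)\coth(s)w(s))$ on $(0,+\infty)$; the bowl is the rotationally invariant translator given by $\hat f\circ\tau$, where $\hat f(s)=\int\hat w(s)\,ds+f_0$. *)

(* Defs.v *)
From HB Require Import structures.
From mathcomp Require Import all_boot all_order all_algebra.
From mathcomp Require Import all_classical all_reals all_analysis.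

Set Implicit Arguments.
Unset Strict Implicit.
Unset Printing Implicit Defensive.

Import Order.TTheory GRing.Theory Num.Theory.
Import numFieldNormedType.Exports.

Local Open Scope classical_set_scope.
Local Open Scope ring_scope.

Section Calculus.
Variables (R : realType) (n : nat) (V : normedModType R).

Definition partial (i : 'I_n) (f : 'rV[R]_n -> V) (x : 'rV[R]_n) : V :=
  'D_(delta_mx 0 i) f x.

(* Meant for open U. *)
Definition C1_on (U : set 'rV[R]_n) (f : 'rV[R]_n -> V) : Prop :=
  forall x, U x -> forall i,
    derivable f x (delta_mx 0 i) /\ {for x, continuous (partial i f)}.

Definition C2_on (U : set 'rV[R]_n) (f : 'rV[R]_n -> V) : Prop :=
  C1_on U f /\ forall i, C1_on U (partial i f).

(* Metric coefficients, in the coordinates of the parametrization X, of the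
   metric that the bilinear form b of the ambient space induces. *)
Definition gram (b : V -> V -> R) (X : 'rV[R]_n -> V) (x : 'rV[R]_n) : 'M[R]_n :=
  \matrix_(i, j) b (partial i X x) (partial j X x).

End Calculus.

Section HyperbolicSpace.
Variables (R : realType) (n : nat).

Definition last_coord (p : 'rV[R]_(n + 1)) : R := p 0 (rshift n ord0).

Definition lorentz (p q : 'rV[R]_(n + 1)) : R :=
  \sum_(i < n) p 0 (lshift 1 i) * q 0 (lshift 1 i)
  - last_coord p * last_coord q.

Definition hyperboloid : set 'rV[R]_(n + 1) :=
  [set p | lorentz p p = -1 /\ 0 < last_coord p].

Definition tau (p : 'rV[R]_(n + 1)) : R :=
  ln (Num.sqrt (last_coord p ^+ 2 - 1) + last_coord p).

Definition tau_preimage (I : set R) : set 'rV[R]_(n + 1) :=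
  hyperboloid `&` tau @^-1` I.

(* A global chart: chart is a diffeomorphism from R^n onto the hyperboloid,
   with inverse the projection lsubmx on the first n coordinates. *)
Definition chart (x : 'rV[R]_n) : 'rV[R]_(n + 1) :=
  row_mx x (Num.sqrt (1 + \sum_(i < n) x 0 i ^+ 2))%:M.

Definition C2_hyp (Om : set 'rV[R]_(n + 1)) (u : 'rV[R]_(n + 1) -> R) : Prop :=
  C2_on (chart @^-1` Om) (u \o chart : 'rV[R]_n -> R^o).

(* grad u = sum_ij g^ij (d_j u) d_i for the induced metric g, as a vector
   tangent to the hyperboloid. *)
Definition hgrad (u : 'rV[R]_(n + 1) -> R) (p : 'rV[R]_(n + 1))
    : 'rV[R]_(n + 1) :=
  let x : 'rV[R]_n := lsubmx p in
  let ginv := invmx (gram lorentz chart x) in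
  \sum_(i < n) \sum_(j < n)
    (ginv i j * partial j (u \o chart : 'rV[R]_n -> R^o) x) *: partial i chart x.

Definition spacelike_on (Om : set 'rV[R]_(n + 1)) (u : 'rV[R]_(n + 1) -> R)
    : Prop :=
  forall p, Om p -> Num.sqrt (lorentz (hgrad u p) (hgrad u p)) < 1.

End HyperbolicSpace.

Section LorentzianProduct.
Variables (R : realType) (n : nat).

(* H^n x_{-1} R is handled as a submanifold of L^{n+1} x R, whose metric
   <,>_L - dt^2 induces g_{H^n} - dt^2 on it. *)
Definition prod_form (X Y : 'rV[R]_(n + 1) * R^o) : R :=
  lorentz X.1 Y.1 - X.2 * Y.2.

(* Orthogonal projection of L^{n+1} x R onto the tangent space of H^n x R
   at q; recall that <q.1, q.1>_L = -1. *)
Definition tangent_proj (q X : 'rV[R]_(n + 1) * R^o) : 'rV[R]_(n + 1) * R^o :=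
  (X.1 + lorentz X.1 q.1 *: q.1, X.2).

Definition partial_t : 'rV[R]_(n + 1) * R^o := (0, 1).

Section Immersion.
Variable F : 'rV[R]_n -> 'rV[R]_(n + 1) * R^o.

Definition inv_metric (x : 'rV[R]_n) : 'M[R]_n := invmx (gram prod_form F x).

(* The component X^\perp normal to the immersion F at the parameter x. *)
Definition normal_part (x : 'rV[R]_n) (X : 'rV[R]_(n + 1) * R^o)
    : 'rV[R]_(n + 1) * R^o :=
  X - \sum_(i < n) \sum_(j < n)
        (inv_metric x i j * prod_form X (partial i F x)) *: partial j F x.

(* The Levi-Civita connection of H^n x R is the tangential part of the flat
   derivative of L^{n+1} x R. *)
Definition second_fund_form (x : 'rV[R]_n) (i j : 'I_n)
    : 'rV[R]_(n + 1) * R^o :=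
  normal_part x (tangent_proj (F x) (partial i (partial j F) x)).

Definition mean_curvature_vector (x : 'rV[R]_n) : 'rV[R]_(n + 1) * R^o :=
  \sum_(i < n) \sum_(j < n) inv_metric x i j *: second_fund_form x i j.

End Immersion.

Definition graph (u : 'rV[R]_(n + 1) -> R) (p : 'rV[R]_(n + 1))
    : 'rV[R]_(n + 1) * R^o := (p, u p).

Definition translator_on (Om : set 'rV[R]_(n + 1)) (u : 'rV[R]_(n + 1) -> R)
    : Prop :=
  forall p, Om p ->
    mean_curvature_vector (graph u \o @chart R n) (lsubmx p)
    = normal_part (graph u \o @chart R n) (lsubmx p) partial_t.

End LorentzianProduct.

Section Profile.
Variables (R : realType) (n : nat).

Definition coth (s : R) : R := (expR s + expR (- s)) / (expR s - expR (- s)).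

Definition slope_rhs (s w : R) : R :=
  (1 - w ^+ 2) * (1 - n.-1%:R * coth s * w).

Definition profile_ode (f : R -> R) : Prop :=
  forall s, 0 < s ->
    [/\ derivable f s 1, derivable (derive1 f) s 1
      & derive1 (derive1 f) s = slope_rhs s (derive1 f s)].

Definition bowl_slope (w : R -> R) : Prop :=
  [/\ {within `[0, +oo[, continuous w},
      w 0 = 0,
      forall s, 0 <= s -> -1 < w s < 1
    & forall s, 0 < s -> derivable w s 1 /\ derive1 w s = slope_rhs s (w s)].

End Profile.

(* Main.v *)
(* Write w = f', m = n - 1, sg = sinh ^ m. The substitution z = sg w / sqrt (1 - w^2)
   turns the slope equation with |w| < 1 into z' = sqrt (sg^2 + z^2), whose right-hand
   side is 1-Lipschitz in z and continuous on all of R, also at s = 0. Hence every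
   solution given on an interval extends to R, it is determined by z(0), and
   w = z / sqrt (sg^2 + z^2) tends to the sign of z(0) at 0 when z(0) <> 0. When z(0) = 0,
   comparison of derivatives gives 0 <= w <= s e^s, so w is the bowl slope. Solutions with
   |w| >= 1 satisfy w^2 - 1 = O((1 - e^(-2s))^2), hence |w| -> 1.

   For the geometric part it suffices to evaluate the translator equation at the points
   r e_1 of the chart, where the metric of the graph is diagonal: pairing the equation with
   a normal vector gives the profile equation for f(s) = u(sinh(s) e_1), the second
   derivatives in the other directions being those of u(sqrt(r^2 + t^2) e_1) at t = 0. *)

Require Import Defs.
From HB Require Import structures.
From mathcomp Require Import all_boot all_order all_algebra.
From mathcomp Require Import all_classical all_reals all_analysis.
From mathcomp Require Import ring lra.
Import Order.TTheory GRing.Theory Num.Theory.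
Import numFieldNormedType.Exports.
Local Open Scope classical_set_scope.
Local Open Scope ring_scope.

Set Implicit Arguments.
Unset Strict Implicit.
Unset Printing Implicit Defensive.

(** * Differential calculus on the real line *)

(** The quantity [z] comes from the divergence form of the equation: for a radial function it reads
    [(sg w / sqrt (1 - w^2))' = sg / sqrt (1 - w^2)], so [z] is, up to a constant, the flux of
    [grad u / sqrt (1 - |grad u|^2)] through the geodesic sphere of radius [s]. The obstacle is the
    slope equation itself: [coth] has a pole at 0, which makes the bowl a singular initial value
    problem, and the right-hand side is cubic in [w], so that solutions on a small interval have no
    evident extension. Both difficulties vanish for [z]: 0 becomes an ordinary point, and the three
    types are told apart by the sign of the flux there. *)

Section RealCalculus.
Variable R : realType.
Implicit Types (f g df : R -> R) (a b c s t x y : R).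

(* Not a class, unlike [is_derive]: the derivative is then computed by the rules
   applied in a proof, and not by instance resolution. *)
Definition has_derive f x (d : R) : Prop := is_derive x 1 f d.

Lemma has_derive_eq f x (d d' : R) :
  has_derive f x d -> d = d' -> has_derive f x d'.
Proof. by move=> + <-. Qed.

Lemma has_derive_cst (c : R) x : has_derive (fun=> c) x 0.
Proof. exact: is_derive_cst. Qed.

Lemma has_derive_id x : has_derive (fun y => y) x 1.
Proof. exact: is_derive_id. Qed.

Lemma has_derive_expR x : has_derive expR x (expR x).
Proof. exact: is_derive_expR. Qed.

Lemma has_derive_ln x : 0 < x -> has_derive (@ln R) x x^-1.
Proof. exact: is_derive1_ln. Qed.

Lemma has_derive_add f g x (df dg : R) :
  has_derive f x df -> has_derive g x dg ->
  has_derive (fun y => f y + g y) x (df + dg).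
Proof. by move=> ? ?; exact: is_deriveD. Qed.

Lemma has_derive_opp f x (df : R) :
  has_derive f x df -> has_derive (fun y => - f y) x (- df).
Proof. by move=> ?; exact: is_deriveN. Qed.

Lemma has_derive_mul f g x (df dg : R) :
  has_derive f x df -> has_derive g x dg ->
  has_derive (fun y => f y * g y) x (f x * dg + g x * df).
Proof. by move=> ? ?; exact: is_deriveM. Qed.

Lemma has_derive_inv f x (df : R) : f x != 0 ->
  has_derive f x df -> has_derive (fun y => (f y)^-1) x (- df / f x ^+ 2).
Proof.
move=> fx0 fdf; apply: has_derive_eq (is_deriveV fx0 fdf) _.
by rewrite scaleNr mulNr [in RHS]mulrC.
Qed.

Lemma has_derive_exp f n x (df : R) : has_derive f x df ->
  has_derive (fun y => f y ^+ n) x (n%:R * f x ^+ n.-1 * df).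
Proof. by move=> fdf; have := @is_deriveX _ _ f n x 1 df fdf; rewrite exprfctE. Qed.

Lemma has_derive_comp g f x (dg df : R) :
  has_derive g (f x) dg -> has_derive f x df ->
  has_derive (fun y => g (f y)) x (dg * df).
Proof. by move=> ? ?; exact: is_derive1_comp. Qed.

Lemma has_derive_sqrt f x (df : R) : 0 < f x -> has_derive f x df ->
  has_derive (fun y => Num.sqrt (f y)) x ((2 * Num.sqrt (f x))^-1 * df).
Proof. by move=> fx0 fdf; apply: has_derive_comp fdf; exact: is_derive1_sqrt. Qed.

Lemma has_derive_continuous f x (df : R) :
  has_derive f x df -> {for x, continuous f}.
Proof.
by move=> [? _]; exact/differentiable_continuous/derivable1_diffP.
Qed.

Lemma has_derive_derive1 f x (df : R) : has_derive f x df -> derive1 f x = df.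
Proof. by rewrite derive1E => -[]. Qed.

Lemma derivable_has_derive f x :
  derivable f x 1 -> has_derive f x (derive1 f x).
Proof. by move=> dfx; rewrite derive1E; exact: derivableP dfx. Qed.

Lemma le_of_derive_ge0 f df a b : a <= b ->
  (forall x, a <= x <= b -> has_derive f x (df x)) ->
  (forall x, a <= x <= b -> 0 <= df x) -> f a <= f b.
Proof.
move=> ab fd d0; have dab x : x \in `]a, b[ -> a <= x <= b.
  by rewrite in_itv/= => /andP[/ltW -> /ltW ->].
have [||c cab E] := @MVT_segment R f df a b ab.
- by move=> x /dab/fd.
- apply: continuous_in_subspaceT => x; rewrite inE/= in_itv/= => /fd.
  exact: has_derive_continuous.
- by rewrite -subr_ge0 E mulr_ge0 ?subr_ge0 ?d0//; move: cab; rewrite in_itv.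
Qed.

Lemma norm_diff_le_of_derive f df g dg a b : a <= b ->
  (forall x, a <= x <= b -> has_derive f x (df x)) ->
  (forall x, a <= x <= b -> has_derive g x (dg x)) ->
  (forall x, a <= x <= b -> `|df x| <= dg x) -> `|f b - f a| <= g b - g a.
Proof.
move=> ab fd gd le; rewrite ler_norml; apply/andP; split.
- have : g a + f a <= g b + f b; last by lra.
  apply: (@le_of_derive_ge0 (fun x => g x + f x) (fun x => dg x + df x)) => // x xab.
    by apply: has_derive_add; [exact: gd|exact: fd].
  by have := le x xab; rewrite ler_norml => /andP[? ?]; lra.
- have : g a - f a <= g b - f b; last by lra.
  apply: (@le_of_derive_ge0 (fun x => g x - f x) (fun x => dg x - df x)) => // x xab.
    by apply: has_derive_add; [exact: gd|apply: has_derive_opp; exact: fd].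
  by have := le x xab; rewrite ler_norml => /andP[? ?]; lra.
Qed.

Lemma eq_of_derive_eq0 f a b : a <= b ->
  (forall x, a <= x <= b -> has_derive f x 0) -> f a = f b.
Proof.
move=> ab fd; apply/eqP; rewrite eq_sym -subr_eq0 -normr_le0.
have := @norm_diff_le_of_derive f (cst 0) (cst 0) (cst 0) a b ab fd.
rewrite /= subrr; apply=> x _; first exact: has_derive_cst.
by rewrite normr0.
Qed.

Lemma antiderivative_exists g : continuous g ->
  exists G : R -> R, forall x, has_derive G x (g x).
Proof.
move=> cg; pose mu := @lebesgue_measure R.
pose I a b := (\int[mu]_(t in `[a, b]) g t)%R.
have ig a b : mu.-integrable `[a, b] (EFin \o g).
  apply: continuous_compact_integrable; first exact: segment_compact.
  exact: continuous_subspaceT.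
have IB a b c : a <= b -> b <= c -> I a c - I a b = I b c.
  move=> ab bc; rewrite /I Rintegral_itvB ?bnd_simp//.
  rewrite Rintegral_itv_obnd_cbnd//.
  by apply: integrableS (ig b c) => //; apply: subset_itvr; rewrite bnd_simp.
(* The fundamental theorem gives the derivative only to the right of the base point of the integral,
   so the base is moved below both [0] and [s]; by [IE] the difference of integrals does not depend
   on it. *)
pose m s : R := Num.min 0 s - 1.
pose G s := I (m s) s - I (m s) 0.
have ms s : m s < 0 /\ m s < s by rewrite /m; case: (leP 0 s) => ?; split; lra.
have IE a a' s : a <= a' -> a' <= 0 -> a' <= s -> I a s - I a 0 = I a' s - I a' 0.
  by move=> aa' a0 as'; rewrite -(IB a a' s)// -(IB a a' 0)//; ring.
have GE a s : a <= 0 -> a <= s -> G s = I a s - I a 0.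
  move=> a0 as'; have [? ?] := ms s; rewrite /G; have [le|lt] := leP a (m s).
    by rewrite (IE a (m s))// ltW.
  by rewrite (IE (m s) a)// ltW.
exists G => x; have [mx0 mxx] := ms x.
apply: (@near_eq_is_derive _ _ _ (fun s => I (m x) s - I (m x) 0)).
  near=> s; rewrite (GE (m x)) ?ltW//.
  by near: s; exact: lt_nbhsr.
rewrite -[g x]addr0; apply: has_derive_add; last exact: has_derive_cst.
have x1 : x < x + 1 by rewrite ltrDl.
have [dI E] := continuous_FTC1_closed x1 (ig _ _) mxx (cg x).
by rewrite -E derive1E; exact: derivableP.
Unshelve. all: by end_near. Qed.

(** The substitution [x = expR y] carries the half-line, where alone [g] is continuous, onto all of
    [R]. *)
Lemma antiderivative_pos_exists g :
  (forall x, 0 < x -> {for x, continuous g}) ->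
  exists G : R -> R, forall x, 0 < x -> has_derive G x (g x).
Proof.
move=> cg; have [|G GP] := @antiderivative_exists (fun y => g (expR y) * expR y).
  move=> y; apply: continuousM; last exact: continuous_expR.
  apply: continuous_comp; first exact: continuous_expR.
  exact/cg/expR_gt0.
exists (fun x => G (ln x)) => x x0.
apply: has_derive_eq; first by apply: has_derive_comp; [exact: GP|exact: has_derive_ln].
by rewrite lnK ?posrE// mulfK// gt_eqF.
Qed.

End RealCalculus.

Lemma geometric_cvg (R : realType) (a : nat -> R) (c : R) :
  (forall k, `|a k.+1 - a k| <= c / 2 ^+ k) ->
  cvgn a /\ forall k, `|limn a - a k| <= 2 * c / 2 ^+ k.
Proof.
move=> ac; have c0 : 0 <= c by have := le_trans (normr_ge0 _) (ac 0%N); rewrite expr0 divr1.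
have step k : 2 * c / 2 ^+ k.+1 = c / 2 ^+ k.
  by rewrite exprS invfM; field; rewrite expf_neq0.
have half k : c / 2 ^+ k = 2 * c / 2 ^+ k - c / 2 ^+ k by ring.
have le k m : `|a (k + m)%N - a k| <= 2 * c / 2 ^+ k - 2 * c / 2 ^+ (k + m).
  elim: m => [|m IH]; first by rewrite addn0 !subrr normr0.
  rewrite addnS -(subrKA (a (k + m)%N)) step.
  rewrite (le_trans (ler_normD _ _))//.
  by have := ac (k + m)%N; have := half (k + m)%N; lra.
have pw k : 0 <= 2 * c / 2 ^+ k by rewrite divr_ge0 ?mulr_ge0 ?exprn_ge0.
have le' k m : `|a (k + m)%N - a k| <= 2 * c / 2 ^+ k.
  by rewrite (le_trans (le k m))// gerBl.
have ca : cvgn a.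
  (* [p k] is the sum of the tail of the bounds [c / 2 ^+ j], [j >= k]. Adding it makes the sequence
     nonincreasing, and bounded below by [a 0 - p 0]. *)
  pose p k := 2 * c / 2 ^+ k.
  have cp : cvgn p.
    have -> : p = geometric (2 * c) 2^-1 by apply/funext => k; rewrite /p /= exprVn.
    by apply/cvgP/cvg_geometric; rewrite ger0_norm ?invr_ge0// invf_lt1 ?ltr1n.
  have -> : a = (a \+ p) \- p by apply/funext => k; rewrite /= addrK.
  apply: is_cvgB cp; apply: nonincreasing_is_cvgn.
    apply/nonincreasing_seqP => k /=; rewrite /p step.
    by have := ac k; have := half k; rewrite ler_norml => ? /andP[]; lra.
  exists (a 0%N - p 0%N) => _ [k _ <-] /=.
  by have := le' 0%N k; have := pw k; rewrite /p add0n ler_norml => ? /andP[]; lra.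
split=> // k.
have cv : `|a m - a k| @[m --> \oo] --> `|limn a - a k|.
  by apply: cvg_norm; apply: cvgB; [exact: ca|exact: cvg_cst].
rewrite -(cvg_lim _ cv)//; apply: limr_le; first by apply/cvg_ex; exists `|limn a - a k|.
near=> m; have km : (k <= m)%N by near: m; exact: nbhs_infty_ge.
by rewrite -(subnKC km).
Unshelve. all: by end_near. Qed.

(** * Global existence and uniqueness for Lipschitz equations *)

Section Picard.
Variables (R : realType) (g : R -> R -> R) (L : R).
Hypothesis g_lip : forall t x y, `|g t x - g t y| <= L * `|x - y|.

(** Gronwall's argument: the squared difference times [expR (- (2 * L) * x)] is nonincreasing and,
    times [expR (2 * L * x)], nondecreasing. The first serves to the right of [t0], the second to
    the left. *)
Lemma lipschitz_ode_unique (J : set R) (u v : R -> R) (t0 t : R) :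
  is_interval J -> J t0 -> J t ->
  (forall x, J x -> has_derive u x (g x (u x))) ->
  (forall x, J x -> has_derive v x (g x (v x))) ->
  u t0 = v t0 -> u t = v t.
Proof.
move=> iJ Jt0 Jt du dv uv0; apply/eqP; rewrite -subr_eq0 -sqrf_eq0 eq_le sqr_ge0 andbT.
pose D x := g x (u x) - g x (v x).
have dd x : J x -> has_derive (fun y => (u y - v y) ^+ 2) x (2 * (u x - v x) * D x).
  move=> Jx; apply: has_derive_exp; apply: has_derive_add; first exact: du.
  by apply: has_derive_opp; exact: dv.
have de (k x : R) : has_derive (fun y => expR (k * y)) x (expR (k * x) * k).
  apply: has_derive_eq.
    apply: has_derive_comp; first exact: has_derive_expR.
    by apply: has_derive_mul; [exact: has_derive_cst|exact: has_derive_id].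
  by rewrite mulr0 addr0 mulr1.
have lin x : `|2 * (u x - v x) * D x| <= 2 * L * (u x - v x) ^+ 2.
  have := g_lip x (u x) (v x); rewrite !normrM gtr0_norm// -(real_normK (num_real (u x - v x))) /D.
  by move=> /(ler_wpM2l (normr_ge0 (u x - v x))); lra.
have [le|/ltW le] := leP t0 t.
- have : - (expR (- (2 * L) * t0) * (u t0 - v t0) ^+ 2) <=
         - (expR (- (2 * L) * t) * (u t - v t) ^+ 2).
    pose df x := - (expR (- (2 * L) * x) * (2 * (u x - v x) * D x) +
                    (u x - v x) ^+ 2 * (expR (- (2 * L) * x) * - (2 * L))).
    apply: (@le_of_derive_ge0 _ (fun x => - (expR (- (2 * L) * x) * (u x - v x) ^+ 2)) df)
      => [//|x xt|x xt].
      have Jx : J x by exact: iJ xt.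
      by apply: has_derive_opp; apply: has_derive_mul; [exact: de|exact: dd].
    have := lin x; rewrite ler_norml => /andP[_ h].
    have -> : df x = expR (- (2 * L) * x) * (2 * L * (u x - v x) ^+ 2 - 2 * (u x - v x) * D x).
      by rewrite /df; ring.
    by rewrite mulr_ge0 ?expR_ge0 ?subr_ge0.
  by rewrite uv0 subrr expr0n mulr0 oppr0 oppr_ge0 pmulr_rle0// expR_gt0.
- have : expR (2 * L * t) * (u t - v t) ^+ 2 <= expR (2 * L * t0) * (u t0 - v t0) ^+ 2.
    pose df x := expR (2 * L * x) * (2 * (u x - v x) * D x) +
                    (u x - v x) ^+ 2 * (expR (2 * L * x) * (2 * L)).
    apply: (@le_of_derive_ge0 _ (fun x => expR (2 * L * x) * (u x - v x) ^+ 2) df)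
      => [//|x xt|x xt].
      have Jx : J x by exact: iJ xt.
      by apply: has_derive_mul; [exact: de|exact: dd].
    have := lin x; rewrite ler_norml => /andP[h _].
    have -> : df x = expR (2 * L * x) * (2 * L * (u x - v x) ^+ 2 + 2 * (u x - v x) * D x).
      by rewrite /df; ring.
    by rewrite mulr_ge0 ?expR_ge0 //; lra.
  by rewrite uv0 subrr expr0n mulr0 pmulr_rle0// expR_gt0.
Qed.

Lemma continuous_bounded_near (h : R -> R) (t0 r : R) : continuous h ->
  exists M, forall t, `|t - t0| <= r -> h t <= M.
Proof.
move=> ch; have [r0|r0] := leP 0 r; last first.
  by exists 0 => t le; have := le_lt_trans le r0; rewrite normr_lt0.
have [||c _ hc] := @EVT_max R h (t0 - r) (t0 + r).
- lra.
- exact: continuous_subspaceT.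
by exists (h c) => t; rewrite ler_distl => tr; apply: hc; rewrite in_itv.
Qed.

(* In the norm weighted by the even function [e], whose primitive [s] is at most
   [e / (2 * L)], Picard's iteration contracts by a factor 2, on any interval. *)
Let e (t0 t : R) := expR (2 * L * (t - t0)) + expR (- (2 * L) * (t - t0)).
Let s (t0 t : R) := (expR (2 * L * (t - t0)) - expR (- (2 * L) * (t - t0))) / (2 * L).

Let has_derive_expM (k t0 t : R) :
  has_derive (fun t => expR (k * (t - t0))) t (expR (k * (t - t0)) * k).
Proof.
apply: has_derive_eq.
  apply: has_derive_comp; first exact: has_derive_expR.
  apply: has_derive_mul; first exact: has_derive_cst.
  by apply: has_derive_add; [exact: has_derive_id|exact: has_derive_cst].
by rewrite mulr0 addr0 addr0 mulr1.
Qed.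

Hypothesis L_gt0 : 0 < L.

Let has_derive_s (t0 t : R) : has_derive (s t0) t (e t0 t).
Proof.
rewrite /s; apply: has_derive_eq.
  apply: has_derive_mul; last exact: has_derive_cst.
  by apply: has_derive_add; last apply: has_derive_opp; exact: has_derive_expM.
by rewrite mulr0 add0r /e; field; rewrite gt_eqF.
Qed.

Let continuous_e (t0 : R) : continuous (e t0).
Proof.
move=> t; apply: has_derive_continuous.
by rewrite /e; apply: has_derive_add; exact: has_derive_expM.
Qed.

Let norm_s_le (t0 t : R) : `|s t0 t| <= e t0 t / (2 * L).
Proof.
have L2 : 0 < 2 * L by rewrite mulr_gt0.
rewrite /s normrM (gtr0_norm (x := (2 * L)^-1)) ?invr_gt0// ler_pM2r ?invr_gt0//.
by rewrite (le_trans (ler_normB _ _))// !ger0_norm ?expR_ge0.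
Qed.

(** Compare [f] with [C * s], which also vanishes at [t0]. For [C = L * c] the bound is [c * e / 2]:
    the Lipschitz constant cancels and a factor 1/2 is gained. *)
Let growth (t0 r C t : R) (f df : R -> R) : 0 <= C -> f t0 = 0 ->
  (forall x, has_derive f x (df x)) ->
  (forall x, `|x - t0| <= r -> `|df x| <= C * e t0 x) ->
  `|t - t0| <= r -> `|f t| <= C * e t0 t / (2 * L).
Proof.
move=> C0 f0 fd le; rewrite ler_distl => /andP[tr1 tr2].
have s0 : s t0 t0 = 0 by rewrite /s subrr !mulr0 expR0 subrr mul0r.
have ds x : has_derive (fun x => C * s t0 x) x (C * e t0 x).
  apply: has_derive_eq; first by apply: has_derive_mul; [exact: has_derive_cst|exact: has_derive_s].
  by rewrite mulr0 addr0.
suff: `|f t| <= C * `|s t0 t|.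
  by move=> /le_trans; apply; rewrite -mulrA ler_wpM2l.
have C0e x : C * s t0 x <= C * `|s t0 x| by rewrite ler_wpM2l// ler_norm.
have [t0t|/ltW tt0] := leP t0 t.
- apply: le_trans (C0e t).
  have := @norm_diff_le_of_derive R f df _ _ t0 t t0t (fun x _ => fd x) (fun x _ => ds x).
  rewrite f0 s0 mulr0 !subr0; apply=> x /andP[x1 x2].
  by apply: le; rewrite ler_distl; apply/andP; split; lra.
- rewrite -normrN; apply: (@le_trans _ _ (- (C * s t0 t))); last first.
    by rewrite -mulrN ler_wpM2l// -normrN ler_norm.
  have := @norm_diff_le_of_derive R f df _ _ t t0 tt0 (fun x _ => fd x) (fun x _ => ds x).
  rewrite f0 s0 mulr0 !sub0r; apply=> x /andP[x1 x2].
  by apply: le; rewrite ler_distl; apply/andP; split; lra.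
Qed.

Lemma lipschitz_ode_exists (t0 z0 : R) :
  (forall z : R -> R, continuous z -> continuous (fun t => g t (z t))) ->
  exists z : R -> R, z t0 = z0 /\ forall t, has_derive z t (g t (z t)).
Proof.
move=> cg.
(* Choice needs a value for every [h], so a discontinuous [h] gets a dummy one. The additive
   constant in [P] is arbitrary; [T] removes it by subtracting the value at [t0]. *)
have /choice[P PP] (h : R -> R) : exists G : R -> R, continuous h ->
    forall x, has_derive G x (h x).
  have [/antiderivative_exists[G GP]|nch] := pselect (continuous h); first by exists G.
  by exists h => /nch.
pose T z t := z0 + (P (fun t => g t (z t)) t - P (fun t => g t (z t)) t0).
have dT z t : continuous z -> has_derive (T z) t (g t (z t)).
  move=> cz; apply: has_derive_eq.
    apply: has_derive_add; first exact: has_derive_cst.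
    by apply: has_derive_add; [apply: PP; exact: cg|exact: has_derive_cst].
  by rewrite add0r addr0.
have cT z : continuous z -> continuous (T z).
  by move=> cz t; exact: has_derive_continuous (dT z t cz).
pose u k := iter k T (cst z0).
have cu k : continuous (u k).
  by elim: k => [|k IH]; [exact: cst_continuous|exact: cT].
have ut0 k : u k t0 = z0 by case: k => [//|k]; rewrite /u iterS /T subrr addr0.
have e_ge1 t : 1 <= e t0 t.
  rewrite /e; have := expR_ge1Dx (2 * L * (t - t0)).
  by have := expR_ge1Dx (- (2 * L) * (t - t0)); lra.
have step r : exists c, forall t, `|t - t0| <= r -> forall k,
    `|u k.+1 t - u k t| <= c / 2 ^+ k.
  have [|C0 C0P] := @continuous_bounded_near (fun t => `|u 1%N t - u 0%N t|) t0 r.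
    by move=> t; apply: cvg_norm; apply: cvgB; [exact: (cu 1%N)|exact: (cu 0%N)].
  have [E EP] := @continuous_bounded_near (e t0) t0 r (@continuous_e t0).
  pose C := Num.max 0 C0; have C_ge0 : 0 <= C by rewrite le_max lexx.
  (* The weight is carried through the induction, where [growth] halves the bound; it starts because
     [e >= 1]. Only afterwards is the weight bounded by [E] on the ball. *)
  have key k : forall t, `|t - t0| <= r -> `|u k.+1 t - u k t| <= C / 2 ^+ k * e t0 t.
    elim: k => [|k IH] t tr.
      rewrite expr0 divr1; apply: (le_trans (C0P _ tr)).
      by apply: (@le_trans _ _ C); rewrite ?ler_peMr// le_max lexx orbT.
    pose df x := g x (u k.+1 x) - g x (u k x).
    have := @growth t0 r (L * (C / 2 ^+ k)) t (fun x => u k.+2 x - u k.+1 x) df.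
    have -> : L * (C / 2 ^+ k) * e t0 t / (2 * L) = C / 2 ^+ k.+1 * e t0 t.
      by rewrite exprS; field; do ?[apply/andP; split]; rewrite ?expf_neq0 ?(gt_eqF L_gt0).
    apply.
    - by apply: mulr_ge0; [exact: ltW|rewrite divr_ge0 ?exprn_ge0].
    - by rewrite !ut0 subrr.
    - by move=> x; apply: has_derive_add (dT _ x (cu k.+1)) (has_derive_opp (dT _ x (cu k))).
    - move=> x xr; apply: (le_trans (g_lip _ _ _)).
      by rewrite -mulrA; apply: ler_wpM2l; [exact: ltW|exact: IH].
    - exact: tr.
  exists (C * E) => t tr k; apply: (le_trans (key k t tr)).
  rewrite mulrAC ler_wpM2r ?invr_ge0// ler_wpM2l//; exact: EP.
pose Z t := limn (fun k => u k t).
have ZP r : exists c, forall t, `|t - t0| <= r -> forall k, `|Z t - u k t| <= c / 2 ^+ k.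
  have [c cP] := step r; exists (2 * c) => t tr k.
  by have [_] := @geometric_cvg R (fun k => u k t) c (cP t tr).
have small c (eps : R) : 0 < eps -> exists k : nat, c / 2 ^+ k < eps.
  move=> eps0; have : geometric c 2^-1 @ \oo --> (0 : R).
    by apply: cvg_geometric; rewrite ger0_norm ?invr_ge0// invf_lt1 ?ltr1n.
  move=> /cvgrPdist_lt/(_ _ eps0)[k _ /(_ k (leqnn k))] /=; rewrite sub0r normrN exprVn => h.
  by exists k; apply: le_lt_trans h; rewrite ler_norm.
have cZ : continuous Z.
  move=> t; apply/cvgrPdist_lt => eps eps0.
  have [c cP] := ZP (`|t - t0| + 1); have eps3 : 0 < eps / 3 by rewrite divr_gt0.
  have [k kP] := small c (eps / 3) eps3.
  have /cvgrPdist_lt/(_ _ eps3) cuk := cu k t.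
  near=> x.
  have xr : `|x - t0| <= `|t - t0| + 1.
    have tx : `|t - x| < 1 by near: x; exact: (nbhsx_ballx t 1 ltr01).
    by have := ler_normD (x - t) (t - t0); rewrite subrKA (distrC x t); lra.
  have tr : `|t - t0| <= `|t - t0| + 1 by rewrite lerDl.
  have h1 := cP t tr k.
  have h2 := cP x xr k.
  have h3 : `|u k t - u k x| < eps / 3 by near: x; exact: cuk.
  have -> : Z t - Z x = (Z t - u k t) + (u k t - u k x) - (Z x - u k x) by ring.
  rewrite (le_lt_trans (ler_normB _ _))//.
  rewrite (le_lt_trans (lerD (ler_normD _ _) (lexx _)))//; lra.
(* [Z t] and [T Z t] are both compared with [u k.+1 t]: the first by the rate of convergence, the
   second by [growth] applied to [T Z - T (u k)]. *)
have ZT : Z = T Z; last first.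
  exists Z; split=> [|t]; first by rewrite ZT /T subrr addr0.
  by rewrite {1}ZT; exact: dT.
apply/funext => t; have [c cP] := ZP `|t - t0|.
have c0 : 0 <= c.
  by have := le_trans (normr_ge0 _) (cP t (lexx _) 0%N); rewrite expr0 divr1.
apply/eqP; rewrite -subr_eq0 -normr_le0; apply/ler_addgt0Pr => eps eps0; rewrite add0r.
have [k kP] := small (c + c * e t0 t) eps eps0.
apply: le_trans (ltW kP).
have c2k : 0 <= c / 2 ^+ k by rewrite divr_ge0 ?exprn_ge0.
pose df x := g x (Z x) - g x (u k x).
have := @growth t0 `|t - t0| (L * (c / 2 ^+ k)) t (fun x => T Z x - u k.+1 x) df.
have -> : L * (c / 2 ^+ k) * e t0 t / (2 * L) = c / 2 ^+ k * e t0 t / 2.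
  by field; do ?[apply/andP; split]; rewrite ?expf_neq0 ?(gt_eqF L_gt0).
move=> h; have {}h : `|T Z t - u k.+1 t| <= c / 2 ^+ k * e t0 t / 2.
  apply: h => //; first by apply: mulr_ge0; [exact: ltW|].
  - by rewrite ut0 /T subrr addr0 subrr.
  - by move=> x; apply: has_derive_add (dT _ x cZ) (has_derive_opp (dT _ x (cu k))).
  - move=> x xr; apply: (le_trans (g_lip _ _ _)).
    rewrite -mulrA; apply: ler_wpM2l; first exact: ltW.
    by apply: (le_trans (cP x xr k)); rewrite ler_peMr.
have h' := cP t (lexx _) k.+1.
have ck : c / 2 ^+ k.+1 = c / 2 ^+ k / 2 by rewrite exprS invfM; ring.
have ce : 0 <= c / 2 ^+ k * e t0 t by rewrite mulr_ge0// (le_trans ler01).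
have -> : Z t - T Z t = (Z t - u k.+1 t) - (T Z t - u k.+1 t) by ring.
apply: (le_trans (ler_normB _ _)).
have -> : (c + c * e t0 t) / 2 ^+ k = c / 2 ^+ k + c / 2 ^+ k * e t0 t by ring.
lra.
Unshelve. all: by end_near. Qed.

End Picard.
(** * The slope equation *)

Section Hyperbolic.
Variable R : realType.
Implicit Types s : R.

Definition sinh s := (expR s - expR (- s)) / 2.
Definition cosh s := (expR s + expR (- s)) / 2.

Lemma has_derive_expRN s : has_derive (fun y => expR (- y)) s (- expR (- s)).
Proof.
apply: has_derive_eq.
  apply: has_derive_comp; first exact: has_derive_expR.
  by apply: has_derive_opp; exact: has_derive_id.
by rewrite mulrN1.
Qed.

Lemma has_derive_sinh s : has_derive sinh s (cosh s).
Proof.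
apply: has_derive_eq.
  apply: has_derive_mul; last exact: has_derive_cst.
  apply: has_derive_add; first exact: has_derive_expR.
  by apply: has_derive_opp; exact: has_derive_expRN.
by rewrite mulr0 add0r opprK mulrC.
Qed.

Lemma has_derive_cosh s : has_derive cosh s (sinh s).
Proof.
apply: has_derive_eq.
  apply: has_derive_mul; last exact: has_derive_cst.
  by apply: has_derive_add; [exact: has_derive_expR|exact: has_derive_expRN].
by rewrite mulr0 add0r mulrC.
Qed.

Lemma sinh0 : sinh 0 = 0.
Proof. by rewrite /sinh oppr0 subrr mul0r. Qed.

Lemma sinh_gt0 s : 0 < s -> 0 < sinh s.
Proof. by move=> s0; rewrite divr_gt0// subr_gt0 ltr_expR; lra. Qed.

Lemma cosh_gt0 s : 0 < cosh s.
Proof. by rewrite divr_gt0// addr_gt0// expR_gt0. Qed.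

Lemma cosh2 s : cosh s ^+ 2 = 1 + sinh s ^+ 2.
Proof.
have : expR s * expR (- s) = 1 by rewrite expRN mulfV// gt_eqF// expR_gt0.
by rewrite /cosh /sinh; move: (expR s) (expR (- s)) => a b ab; field: ab.
Qed.

Lemma cothE s : coth s = cosh s / sinh s.
Proof. by rewrite /coth /cosh /sinh invfM invrK mulrACA mulVf ?mulr1 ?pnatr_eq0. Qed.

End Hyperbolic.

(** * The regular equation for the flux, and the slopes it produces *)

Section ReducedEquation.
Variables (R : realType) (n : nat).
Hypothesis n_ge2 : (2 <= n)%N.
Implicit Types (s x y : R) (w z : R -> R).

(** Up to a constant factor, the area of the geodesic sphere of radius [s]. *)
Definition sinhX s : R := sinh s ^+ n.-1.

Definition reduced_rhs s x : R := Num.sqrt (sinhX s ^+ 2 + x ^+ 2).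

(** Imposed on all of [R], although only [s > 0] has a geometric meaning: 0 is then an interior
    point, at which initial values can be prescribed. *)
Definition reduced_solution z := forall s, has_derive z s (reduced_rhs s (z s)).

Lemma sinhX0 : sinhX 0 = 0.
Proof. by rewrite /sinhX sinh0 expr0n; case: n n_ge2 => [|[|k]]. Qed.

Lemma sinhX_gt0 s : 0 < s -> 0 < sinhX s.
Proof. by move=> s0; rewrite exprn_gt0// sinh_gt0. Qed.

Lemma has_derive_sinhX s :
  has_derive sinhX s (n.-1%:R * sinh s ^+ n.-2 * cosh s).
Proof. by apply: has_derive_exp; exact: has_derive_sinh. Qed.

Lemma derive_sinhXE s : 0 < s ->
  n.-1%:R * sinh s ^+ n.-2 * cosh s = n.-1%:R * coth s * sinhX s.
Proof.
move=> s0; rewrite cothE /sinhX; case: n n_ge2 => [//|[//|k]] _ /=.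
by rewrite exprS; field; rewrite gt_eqF// sinh_gt0.
Qed.

(** The reverse triangle inequality for the plane vectors [(sinhX s, x)] and [(sinhX s, y)],
    obtained from [p^2 - q^2 = (x - y) (x + y)] and [|x + y| <= p + q]. *)
Lemma reduced_rhs_lip s x y :
  `|reduced_rhs s x - reduced_rhs s y| <= 1 * `|x - y|.
Proof.
rewrite mul1r /reduced_rhs; set a := sinhX s ^+ 2.
have a0 : 0 <= a by exact: sqr_ge0.
set p := Num.sqrt _; set q := Num.sqrt _.
have p2 : p ^+ 2 = a + x ^+ 2 by rewrite sqr_sqrtr// addr_ge0// sqr_ge0.
have q2 : q ^+ 2 = a + y ^+ 2 by rewrite sqr_sqrtr// addr_ge0// sqr_ge0.
have px : `|x| <= p by rewrite -sqrtr_sqr ler_wsqrtr// lerDr.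
have qy : `|y| <= q by rewrite -sqrtr_sqr ler_wsqrtr// lerDr.
have p0 : 0 <= p := sqrtr_ge0 _; have q0 : 0 <= q := sqrtr_ge0 _.
have : 0 <= p + q by rewrite addr_ge0.
rewrite le_eqVlt => /predU1P[pq0|pq0].
  have [-> ->] : p = 0 /\ q = 0 by split; lra.
  by rewrite subrr normr0 normr_ge0.
rewrite -(ler_pM2r pq0) -{1}(gtr0_norm pq0) -normrM -subr_sqr p2 q2.
have -> : a + x ^+ 2 - (a + y ^+ 2) = (x - y) * (x + y) by ring.
by rewrite normrM ler_wpM2l// (le_trans (ler_normD _ _))// lerD.
Qed.

Lemma reduced_rhs_continuous z :
  continuous z -> continuous (fun s => reduced_rhs s (z s)).
Proof.
move=> cz s; apply: continuous_comp; last exact: sqrt_continuous.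
have csX : {for s, continuous sinhX} := has_derive_continuous (has_derive_sinhX s).
by apply: continuousD; apply: (@continuous_comp _ _ _ _ (fun t : R => t ^+ 2));
  [exact: csX|exact: exprn_continuous|exact: cz|exact: exprn_continuous].
Qed.

Lemma reduced_solution_exists s x :
  exists z, z s = x /\ reduced_solution z.
Proof.
exact: (lipschitz_ode_exists reduced_rhs_lip ltr01 s x reduced_rhs_continuous).
Qed.

Lemma reduced_solution_unique (J : set R) w z s t :
  is_interval J -> J s -> J t ->
  (forall x, J x -> has_derive w x (reduced_rhs x (w x))) ->
  (forall x, J x -> has_derive z x (reduced_rhs x (z x))) ->
  w s = z s -> w t = z t.
Proof. exact: (lipschitz_ode_unique reduced_rhs_lip). Qed.

Definition reduced_slope z s : R := z s / reduced_rhs s (z s).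

Lemma reduced_rhs_gt0 s x : 0 < s -> 0 < reduced_rhs s x.
Proof. by move=> s0; rewrite sqrtr_gt0 ltr_pwDl ?sqr_ge0// exprn_gt0// sinhX_gt0. Qed.

Lemma has_derive_reduced_rhs z s : reduced_solution z ->
  0 < reduced_rhs s (z s) ->
  has_derive (fun t => reduced_rhs t (z t)) s
    ((sinhX s * (n.-1%:R * sinh s ^+ n.-2 * cosh s)) / reduced_rhs s (z s) + z s).
Proof.
move=> zP r0; apply: has_derive_eq.
  apply: has_derive_sqrt; first by rewrite -sqrtr_gt0.
  apply: has_derive_add; apply: has_derive_exp; first exact: has_derive_sinhX.
  exact: zP.
rewrite -/(reduced_rhs s (z s)); move: (reduced_rhs s (z s)) r0 => r r0.
by rewrite /= !expr1; field; rewrite gt_eqF.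
Qed.

Lemma has_derive_reduced_slope z s : reduced_solution z -> 0 < s ->
  has_derive (reduced_slope z) s (slope_rhs n s (reduced_slope z s)).
Proof.
move=> zP s0; have r0 := reduced_rhs_gt0 (z s) s0.
apply: has_derive_eq.
  apply: has_derive_mul; first exact: zP.
  by apply: has_derive_inv; [rewrite gt_eqF|exact: has_derive_reduced_rhs].
have : reduced_rhs s (z s) ^+ 2 = sinhX s ^+ 2 + z s ^+ 2.
  by rewrite sqr_sqrtr// addr_ge0// sqr_ge0.
rewrite derive_sinhXE// /slope_rhs /reduced_slope.
move: (reduced_rhs s (z s)) r0 => r r0.
move: (z s) (sinhX s) (n.-1%:R : R) (coth s) => x a m c r2.
have -> : a * (m * c * a) = m * c * (r ^+ 2 - x ^+ 2) by rewrite r2; ring.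
by field; rewrite gt_eqF.
Qed.

(** Positivity of the denominator, rather than of [s], is assumed so that the lemma also applies at
    [s = 0] when [z 0 != 0]. *)
Lemma continuous_reduced_slope z s : reduced_solution z ->
  0 < reduced_rhs s (z s) -> {for s, continuous (reduced_slope z)}.
Proof.
move=> zP r0; apply: has_derive_continuous; apply: has_derive_mul; first exact: zP.
by apply: has_derive_inv; [rewrite gt_eqF|exact: has_derive_reduced_rhs].
Qed.

Lemma reduced_slope_bound z s : 0 < s -> -1 < reduced_slope z s < 1.
Proof.
move=> s0; have r0 := reduced_rhs_gt0 (z s) s0.
rewrite -ltr_norml normrM normfV (gtr0_norm r0) ltr_pdivrMr// mul1r.
rewrite -sqrtr_sqr ltr_sqrt; last by rewrite -sqrtr_gt0.
by rewrite ltrDr exprn_gt0// sinhX_gt0.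
Qed.

Lemma profile_of_slope w (f : R -> R) :
  (forall s, 0 < s -> has_derive w s (slope_rhs n s (w s))) ->
  (forall s, 0 < s -> has_derive f s (w s)) -> profile_ode n f.
Proof.
move=> wP fP s s0; have f'w := has_derive_derive1 (fP s s0).
have d2 : has_derive (derive1 f) s (slope_rhs n s (w s)).
  apply: near_eq_is_derive (wP s s0).
  by near=> t; apply/esym/has_derive_derive1/fP; near: t; exact: lt_nbhsr.
split; first by have [] := fP s s0.
  by case: d2.
by rewrite f'w; exact: has_derive_derive1.
Unshelve. all: by end_near. Qed.

Lemma slope_of_profile (f : R -> R) : profile_ode n f ->
  forall s, 0 < s -> has_derive (derive1 f) s (slope_rhs n s (derive1 f s)).
Proof. by move=> fP s /fP[_ d2 <-]; exact: derivable_has_derive. Qed.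

(* If [w = tanh phi] solves the slope equation, then [y = sinh phi] satisfies
   [(sinhX * y)' = sinhX * sqrt (1 + y ^+ 2)]; [reduce w] is [sinhX * y]. *)
Definition reduce w s : R := sinhX s * w s / Num.sqrt (1 - w s ^+ 2).

Lemma reduced_rhs_reduce w s : 0 < s -> w s ^+ 2 < 1 ->
  reduced_rhs s (reduce w s) = sinhX s / Num.sqrt (1 - w s ^+ 2).
Proof.
move=> s0 w1; have q0 : 0 < Num.sqrt (1 - w s ^+ 2) by rewrite sqrtr_gt0 subr_gt0.
have q2 : Num.sqrt (1 - w s ^+ 2) ^+ 2 = 1 - w s ^+ 2.
  by rewrite sqr_sqrtr// subr_ge0 ltW.
rewrite -[RHS]gtr0_norm; last by rewrite divr_gt0// sinhX_gt0.
rewrite -sqrtr_sqr; congr Num.sqrt; rewrite /reduce.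
move: (Num.sqrt _) q0 q2 => q q0 q2.
rewrite !exprMn exprVn q2; field.
by rewrite subr_eq0 gt_eqF.
Qed.

(** The derivative of [sinhX] contributes [m coth w] and that of [w / sqrt (1 - w^2)] contributes
    [1 - m coth w], both times [sinhX / sqrt (1 - w^2)]: the singular terms cancel. *)
Lemma has_derive_reduce w s : 0 < s -> w s ^+ 2 < 1 ->
  has_derive w s (slope_rhs n s (w s)) ->
  has_derive (reduce w) s (reduced_rhs s (reduce w s)).
Proof.
move=> s0 w1 dw; rewrite reduced_rhs_reduce//.
have q0 : 0 < Num.sqrt (1 - w s ^+ 2) by rewrite sqrtr_gt0 subr_gt0.
have q2 : Num.sqrt (1 - w s ^+ 2) ^+ 2 = 1 - w s ^+ 2.
  by rewrite sqr_sqrtr// subr_ge0 ltW.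
apply: has_derive_eq.
  apply: has_derive_mul.
    by apply: has_derive_mul; [exact: has_derive_sinhX|exact: dw].
  apply: has_derive_inv; first by rewrite gt_eqF.
  apply: has_derive_sqrt; first by rewrite subr_gt0.
  apply: has_derive_add; first exact: has_derive_cst.
  by apply: has_derive_opp; apply: has_derive_exp; exact: dw.
rewrite derive_sinhXE// /slope_rhs.
move: (Num.sqrt (1 - w s ^+ 2)) q0 q2 => q q0 q2; rewrite -q2 /= expr1.
move: (w s) (sinhX s) (coth s) (n.-1%:R : R) q2 => x a c m q2.
have x2 : x ^+ 2 = 1 - q ^+ 2 by rewrite q2; ring.
by field: x2; rewrite gt_eqF.
Qed.

Lemma slope_eq_reduced_slope (J : set R) w s0 : is_interval J -> J s0 ->
  (forall s, J s -> 0 < s) -> (forall s, J s -> w s ^+ 2 < 1) ->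
  (forall s, J s -> has_derive w s (slope_rhs n s (w s))) ->
  exists2 z, reduced_solution z & forall s, J s -> w s = reduced_slope z s.
Proof.
move=> iJ Js0 Jpos w1 dw.
have [z [z0 zP]] := reduced_solution_exists s0 (reduce w s0).
exists z => // s Js; have s_gt0 := Jpos s Js; have w1s := w1 s Js.
have zs : reduce w s = z s.
  apply: (@reduced_solution_unique J _ _ s0) => //.
  by move=> x Jx; apply: has_derive_reduce; [exact: Jpos|exact: w1|exact: dw].
rewrite /reduced_slope -zs reduced_rhs_reduce// /reduce.
have q0 : Num.sqrt (1 - w s ^+ 2) != 0 by rewrite gt_eqF// sqrtr_gt0 subr_gt0.
by field; rewrite q0 gt_eqF// sinhX_gt0.
Qed.

Lemma reduced_slope_to1 z : reduced_solution z -> 0 < z 0 ->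
  reduced_slope z s @[s --> 0^'+] --> (1 : R).
Proof.
move=> zP z0; have r0 : reduced_rhs 0 (z 0) = z 0.
  by rewrite /reduced_rhs sinhX0 expr0n add0r sqrtr_sqr gtr0_norm.
have -> : (1 : R) = reduced_slope z 0 by rewrite /reduced_slope r0 mulfV// gt_eqF.
by apply: cvg_at_right_filter; apply: continuous_reduced_slope; rewrite ?r0.
Qed.

Lemma reduced_slope_toN1 z : reduced_solution z -> z 0 < 0 ->
  reduced_slope z s @[s --> 0^'+] --> (-1 : R).
Proof.
move=> zP z0; have r0 : reduced_rhs 0 (z 0) = - z 0.
  by rewrite /reduced_rhs sinhX0 expr0n add0r sqrtr_sqr ltr0_norm.
have -> : (-1 : R) = reduced_slope z 0.
  by rewrite /reduced_slope r0 invrN mulrN mulfV// lt_eqF.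
by apply: cvg_at_right_filter; apply: continuous_reduced_slope; rewrite ?r0 ?oppr_gt0.
Qed.

(** For [z >= 0], [sqrt (sinhX^2 + z^2) <= sinhX + z], hence [(e^(-x) z)' = e^(-x) (z' - z) <= sinhX
    <= (x sinhX)']. Integrating from 0 gives [e^(-s) z <= s sinhX], and [sinhX] is at most the
    denominator of the slope. *)
Lemma reduced_slope_le z s : reduced_solution z -> z 0 = 0 -> 0 < s ->
  0 <= reduced_slope z s <= s * expR s.
Proof.
move=> zP z0 s0; have z_ge0 x : 0 <= x -> 0 <= z x.
  move=> x0; rewrite -z0; apply: (@le_of_derive_ge0 R z (fun t => reduced_rhs t (z t))) => //.
  by move=> t _; exact: sqrtr_ge0.
have sX_ge0 x : 0 <= x -> 0 <= sinhX x.
  by rewrite le_eqVlt => /predU1P[<-|/sinhX_gt0/ltW//]; rewrite sinhX0.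
have r0 := reduced_rhs_gt0 (z s) s0.
apply/andP; split; first by apply: divr_ge0; [exact/z_ge0/ltW|exact: ltW].
have key : expR (- s) * z s <= s * sinhX s.
  rewrite -subr_ge0.
  pose D x := sinhX x + x * (n.-1%:R * sinh x ^+ n.-2 * cosh x) -
              expR (- x) * (reduced_rhs x (z x) - z x).
  have -> : 0 = 0 * sinhX 0 - expR (- 0) * z 0 by rewrite z0 mul0r mulr0 subrr.
  apply: (@le_of_derive_ge0 R (fun x => x * sinhX x - expR (- x) * z x) D) => [|x _|x /andP[x0 _]].
  - exact: ltW.
  - apply: has_derive_eq.
      apply: has_derive_add.
        by apply: has_derive_mul; [exact: has_derive_id|exact: has_derive_sinhX].
      by apply: has_derive_opp; apply: has_derive_mul; [exact: has_derive_expRN|exact: zP].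
    by rewrite /D; ring.
  - have zx := z_ge0 x x0; have sx := sX_ge0 x x0.
    have le1 : reduced_rhs x (z x) - z x <= sinhX x.
      rewrite lerBlDr -(ger0_norm (addr_ge0 sx zx)) -sqrtr_sqr ler_wsqrtr//.
      by rewrite sqrrD -addrA (addrC (_ *+ 2)) addrA lerDl mulrn_wge0// mulr_ge0.
    have le2 : expR (- x) <= 1 by rewrite -expR0 ler_expR oppr_le0.
    have ge3 : 0 <= reduced_rhs x (z x) - z x.
      by rewrite subr_ge0 -[leLHS]ger0_norm// -sqrtr_sqr ler_wsqrtr// lerDr sqr_ge0.
    have ge4 : 0 <= x * (n.-1%:R * sinh x ^+ n.-2 * cosh x).
      move: x0; rewrite le_eqVlt => /predU1P[<-|x0]; first by rewrite mul0r.
      by rewrite !mulr_ge0 ?exprn_ge0 ?(ltW (cosh_gt0 _)) ?(ltW x0)// ltW// sinh_gt0.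
    have : expR (- x) * (reduced_rhs x (z x) - z x) <= reduced_rhs x (z x) - z x.
      by rewrite ler_piMl.
    by rewrite /D; lra.
rewrite ler_pdivrMr//; have e0 : 0 < expR (- s) := expR_gt0 _.
rewrite -(ler_pM2l e0); apply: (le_trans key).
rewrite mulrA (mulrC _ (s * _)) -(mulrA s) expRN mulfV ?mulr1 ?gt_eqF ?expR_gt0//.
apply: ler_wpM2l; first exact: ltW.
rewrite -[leLHS]ger0_norm; last exact/sX_ge0/ltW.
by rewrite -sqrtr_sqr ler_wsqrtr// lerDl sqr_ge0.
Qed.

Lemma bowl_slope_reduced_slope z : reduced_solution z -> z 0 = 0 ->
  bowl_slope n (reduced_slope z).
Proof.
move=> zP z0; have w0 : reduced_slope z 0 = 0 by rewrite /reduced_slope z0 mul0r.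
split=> //.
- apply/continuous_within_itvcyP; split.
    move=> s; rewrite in_itv/= andbT => s0.
    by apply: continuous_reduced_slope => //; exact: reduced_rhs_gt0.
  (* Numerator and denominator both vanish at 0, so continuity there cannot come from the quotient
     rule. *)
  rewrite w0; apply: (@squeeze_cvgr _ _ _ _ (fun=> 0) (fun s => s * expR s)).
  + by near=> s; apply: reduced_slope_le.
  + exact: cvg_cst.
  + rewrite -[X in _ --> X](mul0r (expR 0)).
    apply: cvg_at_right_filter; apply: (@has_derive_continuous R (fun s => s * expR s) 0).
    by apply: has_derive_mul; [exact: has_derive_id|exact: has_derive_expR].
- move=> s; rewrite le_eqVlt => /predU1P[<-|/reduced_slope_bound//].
  by rewrite w0 oppr_lt0 ltr01.
- move=> s s0; have dw := has_derive_reduced_slope zP s0.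
  by split; [case: dw|exact: has_derive_derive1].
Unshelve. all: by end_near. Qed.

Lemma coth_gt1 s : 0 < s -> 1 < coth s.
Proof.
move=> s0; rewrite cothE ltr_pdivlMr ?sinh_gt0// mul1r /sinh /cosh.
by have := expR_gt0 (- s); lra.
Qed.

Lemma has_derive_coth s : 0 < s -> exists d : R, has_derive (@coth R) s d.
Proof.
move=> s0; have -> : @coth R = fun x => cosh x * (sinh x)^-1.
  by apply/funext => x; rewrite cothE.
eexists; apply: has_derive_mul; first exact: has_derive_cosh.
by apply: has_derive_inv; [rewrite gt_eqF// sinh_gt0|exact: has_derive_sinh].
Qed.

(** * Slopes on the whole half-line, including those of absolute value at least 1 *)

Section GlobalSlope.
Variable w : R -> R.
Hypothesis dw : forall s, 0 < s -> has_derive w s (slope_rhs n s (w s)).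

Lemma slope_continuous s : 0 < s -> {for s, continuous w}.
Proof. by move=> /dw; exact: has_derive_continuous. Qed.

(* [1 - w ^+ 2] solves a linear homogeneous equation, so its sign is constant. *)
Lemma slope_lt1_global s0 s : 0 < s0 -> 0 < s -> w s0 ^+ 2 < 1 -> w s ^+ 2 < 1.
Proof.
move=> s0_gt0 s_gt0 w1.
(* [q] is the coefficient in [(1 - w^2)' = q (1 - w^2)], and [expR (- Q)] the integrating factor
   that makes [v] constant. *)
pose q x := -2 * w x * (1 - n.-1%:R * coth x * w x).
have [x x0|Q QP] := @antiderivative_pos_exists R q.
  have [d dc] := has_derive_coth x0.
  apply: has_derive_continuous; apply: has_derive_mul.
    by apply: has_derive_mul; [exact: has_derive_cst|exact: dw].
  apply: has_derive_add; first exact: has_derive_cst.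
  apply: has_derive_opp; apply: has_derive_mul; last exact: dw.
  by apply: has_derive_mul; [exact: has_derive_cst|exact: dc].
pose v x := (1 - w x ^+ 2) * expR (- Q x).
have dv x : 0 < x -> has_derive v x 0.
  move=> x0; apply: has_derive_eq.
    apply: has_derive_mul.
      apply: has_derive_add; first exact: has_derive_cst.
      by apply: has_derive_opp; apply: has_derive_exp; exact: dw.
    apply: has_derive_comp; first exact: has_derive_expR.
    by apply: has_derive_opp; exact: QP.
  by rewrite /q /slope_rhs /= expr1; ring.
have vE : v s0 = v s.
  have [le|/ltW le] := leP s0 s; [|apply/esym]; apply: eq_of_derive_eq0 le _.
    by move=> x /andP[/(lt_le_trans s0_gt0)/dv].
  by move=> x /andP[/(lt_le_trans s_gt0)/dv].
have : 0 < v s by rewrite -vE mulr_gt0 ?subr_gt0// expR_gt0.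
by rewrite pmulr_lgt0 ?expR_gt0// subr_gt0.
Qed.

Hypothesis w_ge1 : forall s, 0 < s -> 1 <= w s ^+ 2.

(** Equal to [2 e^(-s) sinh s], so its logarithmic derivative is [coth s - 1]; it vanishes at 0. *)
Let k s := 1 - expR (- (2 * s)).

Let k_gt0 s : 0 < s -> 0 < k s.
Proof. by move=> s0; rewrite subr_gt0 -[ltRHS]expR0 ltr_expR oppr_lt0 mulr_gt0. Qed.

Let has_derive_k s : has_derive k s (2 * expR (- (2 * s))).
Proof.
rewrite /k; apply: has_derive_eq.
  apply: has_derive_add; first exact: has_derive_cst.
  apply: has_derive_opp; apply: has_derive_comp; first exact: has_derive_expR.
  by apply: has_derive_opp; apply: has_derive_mul; [exact: has_derive_cst|exact: has_derive_id].
by ring.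
Qed.

Let derive_kE s : 0 < s -> 2 * expR (- (2 * s)) = (coth s - 1) * k s.
Proof.
move=> s0; rewrite cothE /cosh /sinh /k.
have -> : expR (- (2 * s)) = expR (- s) * expR (- s) by rewrite -expRD; congr expR; ring.
have : expR s * expR (- s) = 1 by rewrite expRN mulfV// gt_eqF// expR_gt0.
have : expR s - expR (- s) != 0 by rewrite gt_eqF// subr_gt0 ltr_expR; lra.
move: (expR s) (expR (- s)) => a b ab0 ab; field: ab.
by rewrite ab0.
Qed.

(* [k ^+ 2] solves the equation [v' = 2 * (coth - 1) * v], of which [w ^+ 2 - 1]
   is a supersolution. *)
Let w_sqr_bound s : 0 < s -> s <= 1 ->
  w s ^+ 2 - 1 <= (w 1 ^+ 2 - 1) / k 1 ^+ 2 * k s ^+ 2.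
Proof.
move=> s0 s1; rewrite -ler_pdivrMr ?exprn_gt0 ?k_gt0//.
pose D x := (2 * w x * slope_rhs n x (w x) - 2 * (w x ^+ 2 - 1) * (coth x - 1)) / k x ^+ 2.
apply: (@le_of_derive_ge0 R (fun x => (w x ^+ 2 - 1) / k x ^+ 2) D) => [//|x|x] /andP[sx _].
- have x0 := lt_le_trans s0 sx; have kx := k_gt0 x0; apply: has_derive_eq.
    apply: has_derive_mul.
      apply: has_derive_add; last exact: has_derive_cst.
      by apply: has_derive_exp; exact: dw.
    apply: has_derive_inv; first by rewrite expf_neq0// gt_eqF.
    by apply: has_derive_exp; exact: has_derive_k.
  by rewrite derive_kE// /D /= !expr1; field; rewrite gt_eqF.
- have x0 := lt_le_trans s0 sx; rewrite divr_ge0 ?sqr_ge0//.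
  (* The last factor is nonnegative: with [c = coth x > 1], [m >= 1] and [w <= w^2], one has
     [m c w^2 - w >= (c - 1) w^2 >= c - 1]. *)
  have -> : 2 * w x * slope_rhs n x (w x) - 2 * (w x ^+ 2 - 1) * (coth x - 1) =
      2 * (w x ^+ 2 - 1) * (n.-1%:R * coth x * w x ^+ 2 - w x - (coth x - 1)).
    by rewrite /slope_rhs; ring.
  have w1 := w_ge1 x0; have c1 := coth_gt1 x0.
  rewrite mulr_ge0 ?mulr_ge0 ?subr_ge0//.
  have m1 : 1 <= n.-1%:R :> R by rewrite ler1n; case: n n_ge2 => [|[|]].
  have : coth x * w x ^+ 2 <= n.-1%:R * coth x * w x ^+ 2.
    rewrite -mulrA ler_peMl// mulr_ge0 ?sqr_ge0//; lra.
  have : (coth x - 1) * 1 <= (coth x - 1) * w x ^+ 2 by rewrite ler_wpM2l// subr_ge0 ltW.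
  have : w x <= w x ^+ 2.
    by have [?|?] := leP (w x) 0; [rewrite (le_trans _ (sqr_ge0 _))|nra].
  lra.
Qed.

Let w_same_sign s : 0 < s -> 0 < w 1 * w s.
Proof.
move=> s0; rewrite ltNge; apply/negP => ws.
have w_neq0 x : 0 < x -> w x != 0.
  by move=> /w_ge1; apply: contraTneq => ->; rewrite expr0n -ltNge ltr01.
have ivt a b : 0 < a -> a <= b -> w a * w b <= 0 -> False.
  move=> a0 ab wab; have [||c] := @IVT R w a b 0 ab.
  - apply: continuous_in_subspaceT => x; rewrite inE/= in_itv/= => /andP[ax _].
    exact/slope_continuous/(lt_le_trans a0 ax).
  - by rewrite ge_min le_max; case: (leP (w a) 0) => ?; case: (leP 0 (w b)) => ? //=; nra.
  rewrite in_itv/= => /andP[ac _] wc.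
  by have := w_neq0 c (lt_le_trans a0 ac); rewrite wc eqxx.
by have [le|/ltW le] := leP 1 s; [apply: ivt le ws|rewrite mulrC in ws; apply: ivt le ws].
Qed.

Lemma slope_ge1_cvg :
  w s @[s --> 0^'+] --> (1 : R) \/ w s @[s --> 0^'+] --> (-1 : R).
Proof.
pose B s := (w 1 ^+ 2 - 1) / k 1 ^+ 2 * k s ^+ 2.
have B0 : B s @[s --> 0^'+] --> (0 : R).
  have B00 : B 0 = 0 by rewrite /B /k mulr0 oppr0 expR0 subrr expr0n mulr0.
  rewrite -[X in _ --> X]B00; apply: cvg_at_right_filter; apply: (@has_derive_continuous R B 0).
  apply: has_derive_mul; first exact: has_derive_cst.
  by apply: has_derive_exp; exact: has_derive_k.
have [w1|w1] := ltP 0 (w 1); [left|right].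
- apply/cvgrPdist_le => eps eps0; move/cvgrPdist_le : B0 => /(_ _ eps0) B0.
  near=> s; have s0 : 0 < s by [].
  have Bs : `|0 - B s| <= eps by near: s.
  have s1 : s <= 1 by near: s; exact: nbhs_right_le.
  have := w_sqr_bound s0 s1; rewrite -/(B s).
  move: Bs; rewrite sub0r normrN => /(le_trans (ler_norm _)) Bs.
  have ws0 : 0 < w s by have := w_same_sign s0; rewrite pmulr_rgt0.
  (* Here [w >= 1], so [0 <= w - 1 <= (w - 1) (w + 1) = w^2 - 1 <= B s <= eps]. *)
  have := w_ge1 s0; rewrite ler_norml; nra.
- have w1' : w 1 < 0.
    rewrite lt_neqAle w1 andbT; apply: contraTneq (w_ge1 ltr01) => ->.
    by rewrite expr0n -ltNge ltr01.
  apply/cvgrPdist_le => eps eps0; move/cvgrPdist_le : B0 => /(_ _ eps0) B0.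
  near=> s; have s0 : 0 < s by [].
  have Bs : `|0 - B s| <= eps by near: s.
  have s1 : s <= 1 by near: s; exact: nbhs_right_le.
  have := w_sqr_bound s0 s1; rewrite -/(B s).
  move: Bs; rewrite sub0r normrN => /(le_trans (ler_norm _)) Bs.
  have ws0 : w s < 0 by have := w_same_sign s0; rewrite nmulr_rgt0.
  have := w_ge1 s0; rewrite ler_norml; nra.
Unshelve. all: by end_near. Qed.

End GlobalSlope.

Lemma reduced_slope_primitive z : reduced_solution z ->
  exists f : R -> R, forall s, 0 < s -> has_derive f s (reduced_slope z s).
Proof.
move=> zP; apply: antiderivative_pos_exists => s s0.
exact: has_derive_continuous (has_derive_reduced_slope zP s0).
Qed.

Lemma profile_of_reduced z (f : R -> R) : reduced_solution z ->
  (forall s, 0 < s -> has_derive f s (reduced_slope z s)) -> profile_ode n f.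
Proof.
by move=> zP; apply: profile_of_slope => s; exact: has_derive_reduced_slope.
Qed.

Lemma near0_eq_cvg w z (l : R) : (forall s, 0 < s -> w s = z s) ->
  z s @[s --> 0^'+] --> l -> w s @[s --> 0^'+] --> l.
Proof.
move=> wz; apply: cvg_trans; apply: near_eq_cvg.
by near=> s; rewrite wz.
Unshelve. all: by end_near. Qed.

Lemma profile_classification z0 (f : R -> R) :
  reduced_solution z0 -> z0 0 = 0 -> profile_ode n f ->
  [\/ forall s, 0 < s -> derive1 f s = reduced_slope z0 s,
      derive1 f s @[s --> 0^'+] --> (1 : R)
    | derive1 f s @[s --> 0^'+] --> (-1 : R)].
Proof.
move=> z0P z00 /slope_of_profile dw.
(* [profile_ode] puts no bound on the slope. One point with slope of absolute value below 1 forces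
   this everywhere, and the reduction applies; otherwise the absolute value is at least 1
   throughout. *)
have [[s0 s0_gt0 w1]|w1] := pselect (exists2 s0, 0 < s0 & derive1 f s0 ^+ 2 < 1).
- have [|||s|s|z zP wz] := @slope_eq_reduced_slope `]0, +oo[ (derive1 f) s0.
  + exact: interval_is_interval.
  + by rewrite /= in_itv/= s0_gt0.
  + by move=> s; rewrite /= in_itv/= andbT.
  + rewrite /= in_itv/= andbT => s_gt0; exact: (slope_lt1_global dw s0_gt0 s_gt0 w1).
  + by rewrite /= in_itv/= andbT => s_gt0; exact: dw.
  have {}wz s : 0 < s -> derive1 f s = reduced_slope z s.
    by move=> s_gt0; apply: wz; rewrite /= in_itv/= s_gt0.
  have [z0_lt|z0_gt|zz] := ltgtP (z 0) 0.
  + by apply: Or33; apply: near0_eq_cvg wz (reduced_slope_toN1 zP z0_lt).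
  + by apply: Or32; apply: near0_eq_cvg wz (reduced_slope_to1 zP z0_gt).
  + apply: Or31 => s s_gt0; rewrite wz// /reduced_slope.
    (* Uniqueness is applied with initial point 0, which the slope equation itself would not
       allow. *)
    have -> // : z s = z0 s.
    by apply: (@reduced_solution_unique setT z z0 0 s); rewrite ?zz ?z00.
- have [|to1|toN1] := @slope_ge1_cvg (derive1 f) dw.
  + by move=> s s_gt0; rewrite leNgt; apply/negP => h; apply: w1; exists s.
  + exact: Or32.
  + exact: Or33.
Qed.

Lemma profile_exists_cvg (x : R) : x != 0 ->
  exists f : R -> R, [/\ profile_ode n f, forall s, 0 < s -> -1 < derive1 f s < 1
    & derive1 f s @[s --> 0^'+] --> Num.sg x].
Proof.
move=> x0; have [z [z0 zP]] := reduced_solution_exists 0 x.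
have [f df] := reduced_slope_primitive zP.
have fz s : 0 < s -> derive1 f s = reduced_slope z s by move=> /df/has_derive_derive1.
exists f; split=> [|s s0|]; first exact: profile_of_reduced df.
  by rewrite fz//; exact: reduced_slope_bound.
apply: (near0_eq_cvg fz).
have [xn|xp|/eqP] := ltgtP x 0; last by rewrite (negbTE x0).
  by rewrite ltr0_sg//; apply: reduced_slope_toN1; rewrite ?z0.
by rewrite gtr0_sg//; apply: reduced_slope_to1; rewrite ?z0.
Qed.

Lemma slope_extension (J : set R) (f : R -> R) :
  is_interval J -> (forall s, J s -> 0 < s) ->
  (forall s, J s -> derivable f s 1) ->
  (forall s, J s -> derive1 f s ^+ 2 < 1) ->
  (forall s, J s -> has_derive (derive1 f) s (slope_rhs n s (derive1 f s))) ->
  exists g : R -> R, profile_ode n g /\ forall s, J s -> f s = g s.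
Proof.
(* An empty [J] gives no initial value, but then any global profile will do. *)
move=> iJ Jpos df w1 dw; have [[s0 Js0]|J0] := pselect (exists s0, J s0); last first.
  have [z [_ zP]] := reduced_solution_exists 0 0.
  have [g dg] := reduced_slope_primitive zP; exists g.
  by split=> [|s Js]; [exact: profile_of_reduced dg|case: J0; exists s].
have [z zP fz] := slope_eq_reduced_slope iJ Js0 Jpos w1 dw.
have [g dg] := reduced_slope_primitive zP.
pose c := f s0 - g s0; exists (fun s => g s + c); split.
  apply: profile_of_reduced zP _ => s s_gt0; rewrite -[reduced_slope z s]addr0.
  by apply: has_derive_add; [exact: dg|exact: has_derive_cst].
have dfg s : J s -> has_derive (fun t => f t - g t) s 0.
  move=> Js; have := has_derive_opp (dg s (Jpos s Js)).
  move=> /(has_derive_add (derivable_has_derive (df s Js))).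
  by rewrite fz// subrr.
move=> s Js; suff -> : c = f s - g s by rewrite addrC subrK.
rewrite /c; have [le|/ltW le] := leP s0 s; [|apply/esym];
  apply: (@eq_of_derive_eq0 R (fun t => f t - g t)) le _ => x xs; apply: dfg.
  exact: iJ xs.
exact: iJ xs.
Qed.

End ReducedEquation.
(** * Geometry of the graph along an axis *)

Section DirectionalDerivative.
Variables (R : realType) (V W : normedModType R).

Lemma derive_line (f : V -> W) (x v : V) :
  'D_1 (fun t : R => f (t *: v + x)) (0 : R) = 'D_v f x.
Proof.
rewrite /derive; set g1 := fun h => h^-1 *: _; set g2 := fun h => h^-1 *: _.
suff -> : g1 = g2 by [].
by rewrite funeqE /g1 /g2 => h /=; rewrite addr0 scale0r add0r [_%:A]mulr1.
Qed.

(** Transfers directional derivatives to one real variable, where the rules for [has_derive] compute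
    them. *)
Lemma is_derive_line (f : V -> W) (x v : V) (d : W) :
  is_derive (0 : R) (1 : R) (fun t : R => f (t *: v + x)) d -> is_derive x v f d.
Proof.
move=> [fd fE]; have fx : derivable f x v by apply/derivable1P.
by split=> //; rewrite -fE derive_line.
Qed.

Lemma derive_along_line (f : V -> W) (x v : V) :
  derivable f x v -> is_derive (0 : R) (1 : R) (fun t : R => f (t *: v + x)) ('D_v f x).
Proof.
by move=> fx; split; [exact: (proj1 (derivable1P f x v))|exact: derive_line].
Qed.

Lemma is_derive_scale (f : R -> R) (w : W) (t d : R) :
  has_derive f t d -> is_derive t (1 : R) (fun s => f s *: w) (d *: w).
Proof.
move=> [dft fd]; have /cvg_ex[/= l fl] := dft.
have : h^-1 *: (f (h *: 1 + t) *: w - f t *: w) @[h --> 0^'] --> d *: w.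
  rewrite -fd /derive (cvg_lim _ fl)//.
  have -> : (fun h : R => h^-1 *: (f (h *: 1 + t) *: w - f t *: w)) =
      (fun h => (h^-1 *: (f (h *: 1 + t) - f t)) *: w).
    by apply/funext => h; rewrite -scalerBl scalerA.
  exact: cvgZr_tmp.
move=> h; split; first by apply/cvg_ex; exists (d *: w).
exact: cvg_lim h.
Qed.

Lemma is_derive_pair (W' : normedModType R) (f : V -> W) (g : V -> W') x v df dg :
  is_derive x v f df -> is_derive x v g dg ->
  is_derive x v (fun y => (f y, g y)) (df, dg).
Proof.
move=> [/cvg_ex[/= lf fl] <-] [/cvg_ex[/= lg gl] <-].
have h : h^-1 *: ((f (h *: v + x), g (h *: v + x)) - (f x, g x)) @[h --> 0^']
    --> ('D_v f x, 'D_v g x).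
  rewrite /derive (cvg_lim _ fl)// (cvg_lim _ gl)//.
  exact: (cvg_pair fl gl).
split; first by apply/cvg_ex; exists ('D_v f x, 'D_v g x).
exact: cvg_lim h.
Qed.

End DirectionalDerivative.

Section Geometry.
Variables (R : realType) (m : nat).
Local Notation n := m.+1.
Local Notation e i := (delta_mx 0 i : 'rV[R]_n).
Implicit Types (x a : 'rV[R]_n) (r s t b c : R) (i j : 'I_n).

Definition height x : R := Num.sqrt (1 + \sum_(i < n) x 0 i ^+ 2).

Definition axis r : 'rV[R]_n := r *: e ord0.

Lemma sum_sqr_line i x t :
  \sum_(j < n) (t *: e i + x) 0 j ^+ 2 =
  \sum_(j < n) x 0 j ^+ 2 + (2 * t * x 0 i + t ^+ 2).
Proof.
rewrite (bigD1 i)//= [in RHS](bigD1 i)//= !mxE !eqxx mulr1.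
under eq_bigr => j ji do rewrite !mxE eqxx (negbTE ji) mulr0 add0r.
by ring.
Qed.

Lemma sum_sqr_axis r : \sum_(j < n) axis r 0 j ^+ 2 = r ^+ 2.
Proof.
by rewrite -[axis r]addr0 sum_sqr_line big1 => [|j _]; rewrite mxE ?expr0n// mulr0 !add0r.
Qed.

Lemma height_gt0 x : 0 < height x.
Proof. by rewrite sqrtr_gt0 ltr_pwDl// sumr_ge0// => j _; exact: sqr_ge0. Qed.

Lemma height2 x : height x ^+ 2 = 1 + \sum_(i < n) x 0 i ^+ 2.
Proof. by rewrite sqr_sqrtr// addr_ge0// sumr_ge0// => j _; exact: sqr_ge0. Qed.

Lemma is_derive_height x i : is_derive x (e i) height (x 0 i / height x).
Proof.
apply: is_derive_line.
have -> : (fun t : R => height (t *: e i + x)) =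
    fun t => Num.sqrt (1 + \sum_(j < n) x 0 j ^+ 2 + (2 * x 0 i * t + t ^+ 2)).
  by apply/funext => t; rewrite /height sum_sqr_line; congr Num.sqrt; ring.
apply: has_derive_eq.
  apply: has_derive_sqrt.
    by rewrite mulr0 expr0n !addr0 -sqrtr_gt0; exact: height_gt0.
  apply: has_derive_add; first exact: has_derive_cst.
  apply: has_derive_add; last by apply: has_derive_exp; exact: has_derive_id.
  by apply: has_derive_mul; [exact: has_derive_cst|exact: has_derive_id].
rewrite !mulr0 expr0n !addr0 -/(height x) /=.
by field; rewrite gt_eqF// height_gt0.
Qed.

Lemma is_derive_partial_height x i :
  is_derive x (e i) (partial i (height : 'rV[R]_n -> R^o))
    ((height x)^-1 - x 0 i ^+ 2 / height x ^+ 3).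
Proof.
have -> : partial i (height : 'rV[R]_n -> R^o) = fun x => x 0 i / height x.
  by apply/funext => y; rewrite /partial; have [_] := is_derive_height y i.
apply: is_derive_line; apply: has_derive_eq.
  apply: has_derive_mul.
    have -> : (fun t : R => (t *: e i + x) 0 i) = fun t => t + x 0 i.
      by apply/funext => t; rewrite !mxE !eqxx mulr1.
    by apply: has_derive_add; [exact: has_derive_id|exact: has_derive_cst].
  apply: has_derive_inv; first by rewrite gt_eqF// height_gt0.
  have [dh _] := is_derive_height x i; exact: derive_along_line dh.
have [_ hE] := is_derive_height x i.
by rewrite /= ?derive_line hE !scale0r !add0r addr0; field; rewrite gt_eqF// height_gt0.
Qed.

Lemma is_derive_row_mx a x t (f : R -> R) (df : R) : has_derive f t df ->
  is_derive t (1 : R) (fun s => row_mx (s *: a + x) (f s)%:M : 'rV_(n + 1)) (row_mx a df%:M).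
Proof.
move=> fd; pose row y b : 'rV[R]_(n + 1) := row_mx y b%:M.
have rowD a1 a2 b1 b2 : row a1 b1 + row a2 b2 = row (a1 + a2) (b1 + b2).
  by rewrite /row add_row_mx raddfD.
have rowZ k a1 b1 : k *: row a1 b1 = row (k *: a1) (k * b1).
  by rewrite /row scale_row_mx scale_scalar_mx.
have -> : (fun s => row_mx (s *: a + x) (f s)%:M : 'rV_(n + 1)) =
    fun s => row x 0 + s *: row a 0 + f s *: row 0 1.
  by apply/funext => s; rewrite !rowZ !rowD !mulr0 scaler0 mulr1 !add0r addr0 addrC.
have -> : row_mx a df%:M = 0 + 1 *: row a 0 + df *: row 0 1.
  by rewrite add0r !rowZ !rowD mulr0 scaler0 mulr1 scale1r add0r addr0.
have h0 := is_derive_cst (row x 0) t (1 : R).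
have h1 := is_derive_scale (row a 0) (has_derive_id t).
have h2 := is_derive_scale (row 0 1) fd.
exact: (is_deriveD (is_deriveD h0 h1) h2).
Qed.

Definition ambient a b c : 'rV[R]_(n + 1) * R^o := (row_mx a b%:M, c).

Lemma is_derive_ambient a x t (f g : R -> R) (df dg : R) :
  has_derive f t df -> has_derive g t dg ->
  is_derive t (1 : R) (fun s => ambient (s *: a + x) (f s) (g s)) (ambient a df dg).
Proof. by move=> fd gd; apply: is_derive_pair gd; exact: is_derive_row_mx. Qed.

Lemma lorentz_row_mx a1 a2 b1 b2 :
  lorentz (row_mx a1 b1%:M) (row_mx a2 b2%:M) = \sum_(i < n) a1 0 i * a2 0 i - b1 * b2.
Proof.
rewrite /lorentz /last_coord !row_mxEr !mxE eqxx !mulr1n; congr (_ - _).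
by apply: eq_bigr => i _; rewrite !row_mxEl.
Qed.

Lemma prod_form_ambient a1 a2 b1 b2 c1 c2 :
  prod_form (ambient a1 b1 c1) (ambient a2 b2 c2) =
  \sum_(i < n) a1 0 i * a2 0 i - b1 * b2 - c1 * c2.
Proof. by rewrite /prod_form lorentz_row_mx. Qed.

Lemma lorentzDl (p1 p2 q : 'rV[R]_(n + 1)) :
  lorentz (p1 + p2) q = lorentz p1 q + lorentz p2 q.
Proof.
rewrite /lorentz /last_coord mxE mulrDl opprD addrACA -big_split /=; congr (_ + _).
by apply: eq_bigr => i _; rewrite mxE mulrDl.
Qed.

Lemma lorentzZl k (p q : 'rV[R]_(n + 1)) : lorentz (k *: p) q = k * lorentz p q.
Proof.
rewrite /lorentz /last_coord mxE mulrBr mulr_sumr mulrA; congr (_ - _).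
by apply: eq_bigr => i _; rewrite mxE mulrA.
Qed.

Lemma lorentzC (p q : 'rV[R]_(n + 1)) : lorentz p q = lorentz q p.
Proof.
by rewrite /lorentz mulrC; congr (_ - _); apply: eq_bigr => i _; rewrite mulrC.
Qed.

Lemma prod_formDl (X Y Z : 'rV[R]_(n + 1) * R^o) :
  prod_form (X + Y) Z = prod_form X Z + prod_form Y Z.
Proof. by rewrite /prod_form /= lorentzDl; ring. Qed.

Lemma prod_formZl k (X Y : 'rV[R]_(n + 1) * R^o) :
  prod_form (k *: X) Y = k * prod_form X Y.
Proof. by rewrite /prod_form /= lorentzZl /GRing.scale /=; ring. Qed.

Lemma prod_form_suml (I : Type) (l : seq I) (F : I -> 'rV[R]_(n + 1) * R^o) Y :
  prod_form (\sum_(i <- l) F i) Y = \sum_(i <- l) prod_form (F i) Y.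
Proof.
elim: l => [|k l IH]; last by rewrite !big_cons prod_formDl IH.
by rewrite !big_nil -(scale0r (0 : 'rV[R]_(n + 1) * R^o)) prod_formZl mul0r.
Qed.

Lemma sum_delta_mul i a : \sum_(j < n) e i 0 j * a 0 j = a 0 i.
Proof.
rewrite (bigD1 i)//= mxE !eqxx mul1r big1 ?addr0// => j ji.
by rewrite mxE (negbTE ji) andbF mul0r.
Qed.

Lemma invmx_diag (d : 'rV[R]_n) : (forall i, d 0 i != 0) ->
  invmx (diag_mx d) = diag_mx (\row_i (d 0 i)^-1).
Proof.
move=> d0; have dd : diag_mx d *m diag_mx (\row_i (d 0 i)^-1) = 1%:M.
  apply/matrixP => i j; rewrite mul_diag_mx !mxE.
  by case: eqP => [->|]; rewrite ?mulr0// mulfV.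
have [du _] := mulmx1_unit dd.
by rewrite -[LHS]mulmx1 -dd mulKmx.
Qed.

Lemma sum_diag (W : lmodType R) (d : 'rV[R]_n) (X : 'I_n -> 'I_n -> W) :
  \sum_(i < n) \sum_(j < n) diag_mx d i j *: X i j = \sum_(i < n) d 0 i *: X i i.
Proof.
apply: eq_bigr => i _; rewrite (bigD1 i)//= mxE eqxx mulr1n big1 ?addr0// => j ji.
by rewrite mxE eq_sym (negbTE ji) mulr0n scale0r.
Qed.

(** Pairing with a normal vector discards the tangential correction, so that normal projections
    never have to be computed. *)
Lemma prod_form_normal_part (F : 'rV[R]_n -> 'rV[R]_(n + 1) * R^o) x X N :
  (forall i, prod_form (partial i F x) N = 0) ->
  prod_form (normal_part F x X) N = prod_form X N.
Proof.
move=> FN; rewrite /normal_part prod_formDl -scaleN1r prod_formZl prod_form_suml.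
rewrite big1 ?mulr0 ?addr0// => i _; rewrite prod_form_suml big1// => j _.
by rewrite prod_formZl FN mulr0.
Qed.

Lemma axis0 r : axis r 0 ord0 = r.
Proof. by rewrite !mxE !eqxx mulr1. Qed.

Lemma axis_neq0 r i : i != ord0 -> axis r 0 i = 0.
Proof. by move=> i0; rewrite !mxE (negbTE i0) andbF mulr0. Qed.

Lemma height_axis2 r : height (axis r) ^+ 2 = 1 + r ^+ 2.
Proof. by rewrite height2 sum_sqr_axis. Qed.

Lemma chartE x : chart x = row_mx x (height x)%:M.
Proof. by []. Qed.

Lemma partial_chart x i : partial i (@chart R n) x = row_mx (e i) (x 0 i / height x)%:M.
Proof.
have [dh hE] := is_derive_height x i.
have dl : has_derive (fun t : R => height (t *: e i + x)) 0 (x 0 i / height x).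
  by rewrite /has_derive -hE; exact: derive_along_line.
have [_ <-] // : is_derive x (e i) (@chart R n) (row_mx (e i) (x 0 i / height x)%:M).
by apply: is_derive_line; exact: is_derive_row_mx dl.
Qed.

(** * The translator equation at a point of the axis *)

Section AtAxis.
Variables (u : 'rV[R]_(n + 1) -> R) (r p q : R).
Let U : 'rV[R]_n -> R^o := u \o @chart R n.
Let x := axis r.
Let V := height x.
Hypothesis r_gt0 : 0 < r.
Hypothesis dU : forall i, \forall t \near (0 : R), derivable U (t *: e i + x) (e i).
Hypothesis U1 : forall i, partial i U x = if i == ord0 then p else 0.

Let V_gt0 : 0 < V. Proof. exact: height_gt0. Qed.
Let V_neq0 : V != 0. Proof. by rewrite gt_eqF. Qed.
Let r2 : r ^+ 2 = V ^+ 2 - 1. Proof. by rewrite height_axis2 addrC addKr. Qed.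
Let r_neq0 : r != 0. Proof. by rewrite gt_eqF. Qed.
Let xi i : x 0 i = if i == ord0 then r else 0.
Proof. by case: eqP => [->|/eqP]; [exact: axis0|exact: axis_neq0]. Qed.

(** On the axis the induced metric is diagonal, with radial entry [1 - r^2 / V^2 = 1 / V^2] and the
    others 1. *)
Lemma hgrad_axis : hgrad u (chart x) = (p * V ^+ 2) *: row_mx (e ord0) (r / V)%:M.
Proof.
rewrite /hgrad chartE row_mxKl.
have -> : gram (@lorentz R n) (@chart R n) x =
    diag_mx (\row_i (if i == ord0 then (V ^+ 2)^-1 else 1)).
  apply/matrixP => i j; rewrite [LHS]mxE !partial_chart lorentz_row_mx sum_delta_mul.
  rewrite !xi -/V !mxE eqxx /=.
  case: (eqVneq i j) => [<-|ij].
    case: eqP => _; rewrite ?mul0r ?subr0//= mulr1n.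
    by field: r2.
  case: (eqVneq i ord0) => [i0|i0]; last by rewrite !mul0r subr0.
  have j0 : (j == ord0) = false by rewrite -i0 eq_sym (negbTE ij).
  by rewrite j0 mul0r mulr0 subr0.
rewrite invmx_diag; last first.
  by move=> i; rewrite mxE; case: (i == _); rewrite ?oner_eq0// invr_eq0 expf_neq0 ?V_neq0.
under eq_bigr => i _ do under eq_bigr => j _ do rewrite -scalerA.
rewrite sum_diag (bigD1 ord0)//= big1 ?addr0 => [|i i0].
  by rewrite -/U U1 partial_chart xi !mxE !eqxx -/V invrK scalerA mulrC.
by rewrite -/U U1 (negbTE i0) scale0r scaler0.
Qed.

(** With [r = sinh s] and [f'(s) = p cosh s], the right-hand side is [f'(s)^2]. *)
Lemma lorentz_hgrad_axis :
  lorentz (hgrad u (chart x)) (hgrad u (chart x)) = p ^+ 2 * (1 + r ^+ 2).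
Proof.
rewrite hgrad_axis lorentzZl lorentzC lorentzZl lorentz_row_mx sum_delta_mul !mxE !eqxx /=.
by rewrite mulr1n r2; field: r2.
Qed.

Hypothesis U2 : forall i,
  is_derive x (e i) (partial i U) (if i == ord0 then q else p / r).
Hypothesis spacelike : p ^+ 2 * (1 + r ^+ 2) < 1.

Let F := graph u \o @chart R n.

Let partial_graph (y : 'rV[R]_n) i : derivable U y (e i) ->
  partial i F y = ambient (e i) (y 0 i / height y) (partial i U y).
Proof.
move=> /derive_along_line dUy; have [dh hE] := is_derive_height y i.
have dl : has_derive (fun t : R => height (t *: e i + y)) 0 (y 0 i / height y).
  by rewrite /has_derive -hE; exact: derive_along_line.
have [_ <-] // : is_derive y (e i) F (ambient (e i) (y 0 i / height y) (partial i U y)).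
by apply: is_derive_line; exact: is_derive_ambient dl dUy.
Qed.

Let partial_graph_x i :
  partial i F x = ambient (e i) (x 0 i / V) (if i == ord0 then p else 0).
Proof.
rewrite partial_graph ?U1//.
by have := nbhs_singleton (dU i); rewrite scale0r add0r.
Qed.

(** Pure second derivatives suffice, since the inverse metric of the graph is diagonal at [x]. *)
Let partial2_graph i : partial i (partial i F) x =
  ambient 0 (V^-1 - x 0 i ^+ 2 / V ^+ 3) (if i == ord0 then q else p / r).
Proof.
have [dh2 h2E] := is_derive_partial_height x i.
have dl : has_derive (fun t : R => partial i (height : 'rV[R]_n -> R^o) (t *: e i + x)) 0
    (V^-1 - x 0 i ^+ 2 / V ^+ 3).
  by rewrite /has_derive -h2E; exact: derive_along_line.
have [dU2 U2E] := U2 i.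
have dlU : has_derive (fun t : R => partial i U (t *: e i + x)) 0
    (if i == ord0 then q else p / r).
  by rewrite /has_derive -U2E; exact: derive_along_line.
have := is_derive_ambient 0 (e i) dl dlU; set G := (X in is_derive _ _ X _) => dG.
have [_ <-] // : is_derive x (e i) (partial i F)
   (ambient 0 (V^-1 - x 0 i ^+ 2 / V ^+ 3) (if i == ord0 then q else p / r)).
apply: is_derive_line; apply: near_eq_is_derive dG.
near=> t; rewrite /G scaler0 add0r partial_graph; last by near: t; exact: dU.
by have [_ <-] := is_derive_height (t *: e i + x) i.
Unshelve. all: by end_near. Qed.

(* A normal vector of the graph that is also tangent to the product. *)
Let N := ambient ((p * V ^+ 2) *: e ord0) (p * r * V) 1.

Let sum_mulZ_delta (k : R) (a : 'rV[R]_n) i :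
  \sum_(j < n) a 0 j * (k *: e i) 0 j = k * a 0 i.
Proof.
rewrite -sum_delta_mul mulr_sumr; apply: eq_bigr => j _.
by rewrite mxE; ring.
Qed.

Let normal_N i : prod_form (partial i F x) N = 0.
Proof.
rewrite partial_graph_x prod_form_ambient sum_mulZ_delta xi mxE eqxx /= (eq_sym ord0).
case: eqP => _; rewrite /= ?mulr1n ?mulr0n; last by rewrite !mul0r mulr0 !subr0.
by field: r2.
Qed.

Let metric_F : gram (@prod_form R n) F x =
  diag_mx (\row_i (if i == ord0 then (1 - p ^+ 2 * V ^+ 2) / V ^+ 2 else 1)).
Proof.
apply/matrixP => i j; rewrite [LHS]mxE !partial_graph_x prod_form_ambient sum_delta_mul.
rewrite !xi !mxE eqxx /=.
case: (eqVneq i j) => [<-|ij].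
  case: eqP => _; rewrite ?mul0r ?mulr0 ?subr0//= mulr1n.
  by field: r2.
case: (eqVneq i ord0) => [i0|i0]; last by rewrite !mul0r !subr0.
have j0 : (j == ord0) = false by rewrite -i0 eq_sym (negbTE ij).
  by rewrite j0 mul0r !mulr0 !subr0.
Qed.

(** Space-likeness enters here: it makes the radial entry of the metric nonzero. *)
Let inv_metric_F : inv_metric F x =
  diag_mx (\row_i (if i == ord0 then V ^+ 2 / (1 - p ^+ 2 * V ^+ 2) else 1)).
Proof.
rewrite /inv_metric metric_F invmx_diag => [|i].
  by congr diag_mx; apply/rowP => i; rewrite !mxE; case: eqP; rewrite ?invr1 ?invf_div.
rewrite mxE; case: (i == _); rewrite ?oner_eq0//.
by rewrite mulf_neq0 ?invr_eq0 ?expf_neq0// subr_eq0 gt_eqF// height_axis2.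
Qed.

Let second_fund_form_N i : prod_form (second_fund_form F x i i) N =
  - (V^-1 - x 0 i ^+ 2 / V ^+ 3) * (p * r * V) - (if i == ord0 then q else p / r).
Proof.
rewrite /second_fund_form prod_form_normal_part// partial2_graph.
set b := V^-1 - _; set c := if _ then _ else _.
(* The projection adds a multiple of the position vector on the hyperboloid; this is [F x] with its
   time component [u] removed. *)
have -> : tangent_proj (F x) (ambient 0 b c) =
    ambient 0 b c + (- (b * V)) *: (F x + ambient 0 0 (- u (chart x))).
  rewrite /tangent_proj /= chartE lorentz_row_mx big1 ?sub0r => [|j _]; last by rewrite mxE mul0r.
  congr (_, _); last by rewrite /= subrr scaler0 addr0.
  by rewrite /= raddf0 row_mx0 addr0.
rewrite prod_formDl prod_formZl.
have -> : F x + ambient 0 0 (- u (chart x)) = ambient x V 0.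
  by congr (_, _); rewrite /= ?subrr// raddf0 row_mx0 addr0.
rewrite !prod_form_ambient !sum_mulZ_delta mxE axis0.
(* [N] is orthogonal to the position vector, so the projection does not affect the pairing. *)
have -> : p * V ^+ 2 * r - V * (p * r * V) - 0 * 1 = 0 by ring.
by ring.
Qed.

(** Both sides are paired with [N], and [partial_t] gives -1. The first summand is the radial
    direction; the [m] others contribute equally. *)
Lemma translator_axis :
  mean_curvature_vector F x = normal_part F x (partial_t R n) ->
  (1 + r ^+ 2) * (p * r / (1 + r ^+ 2) + q) / (1 - p ^+ 2 * (1 + r ^+ 2)) +
    m%:R * (p * r + p / r) = 1.
Proof.
move=> /(congr1 (fun X => prod_form X N)); rewrite prod_form_normal_part//.
rewrite /mean_curvature_vector inv_metric_F sum_diag prod_form_suml.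
have -> : partial_t R n = ambient 0 0 1 by rewrite /ambient raddf0 row_mx0.
rewrite prod_form_ambient sum_mulZ_delta mxE mulr0 mul0r !sub0r mulr1.
under eq_bigr => i _ do rewrite prod_formZl second_fund_form_N xi mxE.
rewrite big_ord_recl eqxx; under eq_bigr => i _.
  have -> : (lift ord0 i == ord0) = false by [].
  over.
rewrite sumr_const card_ord -[X in _ + X]mulr_natl expr0n mul0r subr0 mul1r.
have W : 1 - p ^+ 2 * V ^+ 2 != 0 by rewrite subr_eq0 gt_eqF// height_axis2.
have -> : 1 + r ^+ 2 = V ^+ 2 by rewrite -height_axis2.
move=> E; apply/eqP; rewrite -subr_eq0; apply/eqP; move: E => /eqP; rewrite -subr_eq0 => /eqP E.
apply: oppr_inj; rewrite oppr0 -[RHS]E; field: r2.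
by rewrite r_neq0 V_neq0 exprMn W.
Qed.

End AtAxis.

Lemma last_coord_chart x : last_coord (chart x) = height x.
Proof. by rewrite /last_coord chartE row_mxEr mxE eqxx. Qed.

Lemma hyperboloid_chart x : hyperboloid (chart x).
Proof.
split; last by rewrite last_coord_chart height_gt0.
rewrite chartE lorentz_row_mx -expr2 height2.
by under eq_bigr => i _ do rewrite -expr2; ring.
Qed.

Lemma tau_chart x : tau (chart x) =
  ln (Num.sqrt (\sum_(i < n) x 0 i ^+ 2) + Num.sqrt (1 + \sum_(i < n) x 0 i ^+ 2)).
Proof. by rewrite /tau last_coord_chart height2 addrAC subrr add0r. Qed.

Lemma height_axis_sinh s : height (axis (sinh s)) = cosh s.
Proof. by rewrite /height sum_sqr_axis -cosh2 sqrtr_sqr gtr0_norm// cosh_gt0. Qed.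

Lemma tau_axis_sinh s : 0 < s -> tau (chart (axis (sinh s))) = s.
Proof.
move=> s0; rewrite tau_chart -/(height _) height_axis_sinh sum_sqr_axis sqrtr_sqr.
rewrite gtr0_norm ?sinh_gt0// -[RHS]expRK; congr ln.
by rewrite /sinh /cosh; field.
Qed.

(** Keeps a short piece of a coordinate line inside the domain, so that identities valid on the
    domain can be differentiated along it. *)
Lemma near_tau_line (I : set R) x i : open I -> 0 < \sum_(j < n) x 0 j ^+ 2 ->
  I (tau (chart x)) -> \forall t \near (0 : R), I (tau (chart (t *: e i + x))).
Proof.
move=> oI; set Q := \sum_(j < n) _ => Q0 Ix.
pose q (t : R) := Q + (2 * t * x 0 i + t ^+ 2).
have q0 : q 0 = Q by rewrite /q; ring.
have dq : has_derive q 0 (2 * x 0 i).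
  apply: has_derive_eq.
    apply: has_derive_add; first exact: has_derive_cst.
    apply: has_derive_add; last by apply: has_derive_exp; exact: has_derive_id.
    apply: has_derive_mul; last exact: has_derive_cst.
    by apply: has_derive_mul; [exact: has_derive_cst|exact: has_derive_id].
  by rewrite /=; ring.
have cT : {for 0, continuous (fun t : R => ln (Num.sqrt (q t) + Num.sqrt (1 + q t)))}.
  have sq0 : 0 < Num.sqrt (q 0) by rewrite q0 sqrtr_gt0.
  apply: has_derive_continuous; apply: has_derive_comp.
    by apply: has_derive_ln; rewrite ltr_pwDl// sqrtr_ge0.
  apply: has_derive_add; first by apply: has_derive_sqrt dq; rewrite q0.
  apply: has_derive_sqrt; first by rewrite q0 addr_gt0.
  by apply: has_derive_add dq; exact: has_derive_cst.
have : \forall t \near (0 : R), I (ln (Num.sqrt (q t) + Num.sqrt (1 + q t))).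
  apply: cT; apply: open_nbhs_nbhs; split=> //=.
  by rewrite q0 -tau_chart.
by apply: filterS => t; rewrite tau_chart sum_sqr_line.
Qed.

Lemma has_derive_axis (G : 'rV[R]_n -> R^o) r : derivable G (axis r) (e ord0) ->
  has_derive (fun s => G (axis s)) r (partial ord0 G (axis r)).
Proof.
move=> dG; have -> : (fun s => G (axis s)) = fun s => G ((s - r) *: e ord0 + axis r).
  by apply/funext => s; rewrite -scalerDl subrK.
apply: has_derive_eq.
  apply: (@has_derive_comp R (fun t => G (t *: e ord0 + axis r)) (fun s => s - r)).
    by rewrite subrr; exact: derive_along_line.
  by apply: has_derive_add; [exact: has_derive_id|apply: has_derive_opp; exact: has_derive_cst].
by rewrite subr0 mulr1.
Qed.

(** * From a rotationally symmetric translator to its profile *)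

Section SymmetricGraph.
Variables (I : set R) (u : 'rV[R]_(n + 1) -> R).
Hypothesis I_open : open I.
Hypothesis I_pos : forall s, I s -> 0 < s.
Hypothesis u_C2 : C2_hyp (tau_preimage I) u.
Hypothesis u_sym : forall p q : 'rV[R]_(n + 1), tau_preimage I p -> tau_preimage I q ->
  tau p = tau q -> u p = u q.

Let U : 'rV[R]_n -> R^o := u \o @chart R n.
Let P r := partial ord0 U (axis r).

Let chart_in x : I (tau (chart x)) -> tau_preimage I (chart x).
Proof. by split; first exact: hyperboloid_chart. Qed.

Let derivable_U x i : I (tau (chart x)) -> derivable U x (e i).
Proof. by move=> Ix; have [/(_ x (chart_in Ix) i)[]] := u_C2. Qed.

Let derivable_partial_U x i j : I (tau (chart x)) -> derivable (partial i U) x (e j).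
Proof. by move=> Ix; have [_ /(_ i x (chart_in Ix) j)[]] := u_C2. Qed.

Section AtRadius.
Variable r : R.
Hypothesis r_gt0 : 0 < r.
Hypothesis Ir : I (tau (chart (axis r))).

(** The radius in the chart after a displacement by [t] orthogonal to the axis. *)
Let rho t := Num.sqrt (r ^+ 2 + t ^+ 2).

Let rho_gt0 t : 0 < rho t.
Proof. by rewrite sqrtr_gt0 ltr_pwDl ?sqr_ge0// exprn_gt0. Qed.

Let rho2 t : rho t ^+ 2 = r ^+ 2 + t ^+ 2.
Proof. by rewrite sqr_sqrtr// addr_ge0// sqr_ge0. Qed.

Let rho0 : rho 0 = r.
Proof. by rewrite /rho expr0n addr0 sqrtr_sqr gtr0_norm. Qed.

Let has_derive_rho t : has_derive rho t (t / rho t).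
Proof.
apply: has_derive_eq.
  apply: has_derive_sqrt; first by rewrite -sqrtr_gt0; exact: rho_gt0.
  apply: has_derive_add; first exact: has_derive_cst.
  by apply: has_derive_exp; exact: has_derive_id.
by rewrite -/(rho t) /= expr1; field; rewrite gt_eqF.
Qed.

Let sum_sqr_side i t : i != ord0 ->
  \sum_(j < n) (t *: e i + axis r) 0 j ^+ 2 = rho t ^+ 2.
Proof.
by move=> i0; rewrite sum_sqr_line sum_sqr_axis axis_neq0// mulr0 add0r rho2.
Qed.

Let tau_side i t : i != ord0 ->
  tau (chart (t *: e i + axis r)) = tau (chart (axis (rho t))).
Proof. by move=> i0; rewrite !tau_chart sum_sqr_side// sum_sqr_axis. Qed.

(* Rotational symmetry: off the axis, [U] is the composite of its restriction
   to the axis with the radius. *)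
Let U_side i t : i != ord0 -> I (tau (chart (t *: e i + axis r))) ->
  U (t *: e i + axis r) = U (axis (rho t)).
Proof.
move=> i0 It; apply: u_sym; [exact: chart_in| |exact: tau_side].
by apply: chart_in; rewrite -(tau_side _ i0).
Qed.

Let near_line i : \forall t \near (0 : R), I (tau (chart (t *: e i + axis r))).
Proof. by apply: near_tau_line => //; rewrite sum_sqr_axis exprn_gt0. Qed.

(** Stated also for [t != 0], since the transverse second derivative on the axis is obtained by
    differentiating this formula in [t]. *)
Let is_derive_side i t : i != ord0 -> I (tau (chart (t *: e i + axis r))) ->
  is_derive (t *: e i + axis r) (e i) U (P (rho t) * (t / rho t)).
Proof.
move=> i0 It; apply: is_derive_line.
have dPt : has_derive (fun h => U (axis (rho (h + t)))) 0 (P (rho t) * (t / rho t)).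
  apply: has_derive_eq.
    apply: (@has_derive_comp R (fun s => U (axis s)) (fun h => rho (h + t))).
      apply: has_derive_axis; apply: derivable_U.
      by rewrite add0r -(tau_side _ i0).
    apply: has_derive_comp; first exact: has_derive_rho.
    by apply: has_derive_add; [exact: has_derive_id|exact: has_derive_cst].
  by rewrite add0r addr0 mulr1.
apply: near_eq_is_derive dPt.
have : \forall h \near (0 : R), I (tau (chart (h *: e i + (t *: e i + axis r)))).
  by apply: near_tau_line => //; rewrite sum_sqr_side// exprn_gt0.
by apply: filterS => h; rewrite addrA -scalerDl => Ih; rewrite U_side.
Qed.

Lemma spacelike_translator_axis :
  spacelike_on (tau_preimage I) u -> translator_on (tau_preimage I) u ->
  exists q : R, [/\ has_derive P r q, P r ^+ 2 * (1 + r ^+ 2) < 1 &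
    (1 + r ^+ 2) * (P r * r / (1 + r ^+ 2) + q) / (1 - P r ^+ 2 * (1 + r ^+ 2)) +
    m%:R * (P r * r + P r / r) = 1].
Proof.
move=> usp utr; pose q := partial ord0 (partial ord0 U) (axis r).
have dP : has_derive P r q by apply: has_derive_axis; exact: derivable_partial_U.
have dU i : \forall t \near (0 : R), derivable U (t *: e i + axis r) (e i).
  by apply: filterS (near_line i) => t; exact: derivable_U.
have side0 i : i != ord0 -> partial i U (axis r) = 0.
  move=> i0; have := @is_derive_side i 0 i0; rewrite scale0r add0r => /(_ Ir)[_ E].
  by rewrite /partial E mul0r mulr0.
have U1 i : partial i U (axis r) = if i == ord0 then P r else 0.
  by case: eqP => [->//|/eqP/side0].
have U2 i : is_derive (axis r) (e i) (partial i U) (if i == ord0 then q else P r / r).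
  case: (eqVneq i ord0) => [->|i0].
    by split; first exact: derivable_partial_U.
  apply: is_derive_line.
  (* Only [P r] times the derivative [1 / r] of [t / rho t] survives, as [t / rho t] vanishes at
     0. *)
  have dPs : has_derive (fun t => P (rho t) * (t / rho t)) 0 (P r / r).
    apply: has_derive_eq.
      apply: has_derive_mul.
        by apply: has_derive_comp (has_derive_rho 0); rewrite rho0; exact: dP.
      apply: has_derive_mul; first exact: has_derive_id.
      apply: has_derive_inv (has_derive_rho 0).
      by rewrite rho0 gt_eqF.
    by rewrite /= rho0; field; rewrite gt_eqF.
  apply: near_eq_is_derive dPs.
  by apply: filterS (near_line i) => t It; have [_ <-] := is_derive_side i0 It.
have sp : P r ^+ 2 * (1 + r ^+ 2) < 1.
  have := usp _ (chart_in Ir).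
  by rewrite (lorentz_hgrad_axis U1) -[ltRHS]sqrtr1 ltr_sqrt.
exists q; split=> //; apply: (translator_axis r_gt0 dU U1 U2 sp).
by have := utr _ (chart_in Ir); rewrite chartE row_mxKl.
Qed.

End AtRadius.

Lemma symmetric_translator_profile :
  spacelike_on (tau_preimage I) u -> translator_on (tau_preimage I) u ->
  exists f : R -> R,
    [/\ forall p, tau_preimage I p -> u p = f (tau p),
        forall s, I s -> derivable f s 1,
        forall s, I s -> derive1 f s ^+ 2 < 1 &
        forall s, I s -> has_derive (derive1 f) s (slope_rhs n s (derive1 f s))].
Proof.
(* The point of the axis at hyperbolic distance [s] from the origin has chart radius [sinh s]. *)
move=> usp utr; pose f s := U (axis (sinh s)).
have I_axis s : I s -> I (tau (chart (axis (sinh s)))).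
  by move=> Is; rewrite tau_axis_sinh//; exact: I_pos.
have df s : I s -> has_derive f s (P (sinh s) * cosh s).
  move=> Is; apply: (@has_derive_comp R (fun t => U (axis t))); last exact: has_derive_sinh.
  by apply: has_derive_axis; apply: derivable_U; exact: I_axis.
have f'E s : I s -> derive1 f s = P (sinh s) * cosh s.
  by move=> /df; exact: has_derive_derive1.
exists f; split.
- move=> p Ip; have [_ /= Itp] := Ip; apply: u_sym => //.
    by apply: chart_in; exact: I_axis.
  by rewrite tau_axis_sinh//; exact: I_pos.
- by move=> s /df[].
- move=> s Is; rewrite f'E// exprMn cosh2.
  by have [q []] := spacelike_translator_axis (sinh_gt0 (I_pos Is)) (I_axis _ Is) usp utr.
- move=> s Is; have r0 := sinh_gt0 (I_pos Is).
  have [q [dP sp E]] := spacelike_translator_axis r0 (I_axis _ Is) usp utr.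
  have dw : has_derive (fun t => P (sinh t) * cosh t) s
      (P (sinh s) * sinh s + cosh s * (q * cosh s)).
    apply: has_derive_mul; last exact: has_derive_cosh.
    by apply: has_derive_comp; [exact: dP|exact: has_derive_sinh].
  have {}dw : has_derive (derive1 f) s (P (sinh s) * sinh s + cosh s * (q * cosh s)).
    apply: near_eq_is_derive dw.
    have : \forall t \near s, I t by apply: open_nbhs_nbhs.
    by apply: filterS => t It; rewrite f'E.
  apply: has_derive_eq dw _; rewrite f'E// /slope_rhs cothE.
  move: E sp r0; rewrite -cosh2 /=.
  have := cosh2 s; have := cosh_gt0 s.
  move: (P (sinh s)) => p; move: (sinh s) (cosh s) => r c c0 c2 E sp r0.
  have W : 1 - p ^+ 2 * c ^+ 2 != 0 by rewrite gt_eqF// subr_gt0.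
  (* The left side is [f''] and [p * c] is [f']. The translator equation gives the quotient
     [f'' / (1 - f'^2)], in which [p r + p / r = p c^2 / r] is [coth s] times [f']. *)
  have -> : p * r + c * (q * c) = (1 - p ^+ 2 * c ^+ 2) *
      (c ^+ 2 * (p * r / c ^+ 2 + q) / (1 - p ^+ 2 * c ^+ 2)).
    by field; rewrite exprMn W gt_eqF.
  have -> : c ^+ 2 * (p * r / c ^+ 2 + q) / (1 - p ^+ 2 * c ^+ 2) =
     1 - m%:R * (p * r + p / r) by rewrite -[X in _ = X - _]E addrK.
  by field: c2; rewrite gt_eqF.
Qed.

End SymmetricGraph.

End Geometry.

Unset Implicit Arguments.
Set Strict Implicit.
Set Printing Implicit Defensive.

Theorem theorem4p1 (R : realType) (n : nat) (hn : (2 <= n)%N) :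
  (forall (I : set R) (u : 'rV[R]_(n + 1) -> R),
     open I -> is_interval I -> I `<=` `]0, +oo[ ->
     C2_hyp (tau_preimage I) u ->
     (forall p q, tau_preimage I p -> tau_preimage I q -> tau p = tau q ->
        u p = u q) ->
     spacelike_on (tau_preimage I) u ->
     translator_on (tau_preimage I) u ->
     exists f : R -> R,
       profile_ode n f /\
       forall p, tau_preimage I p -> graph u p = (p, f (tau p)))
  /\
  exists hat_w : R -> R,
    [/\ bowl_slope n hat_w,
        forall f : R -> R, profile_ode n f ->
          [\/ forall s, 0 < s -> derive1 f s = hat_w s,
              derive1 f s @[s --> 0^'+] --> (1 : R)
            | derive1 f s @[s --> 0^'+] --> (-1 : R)],
        exists2 f : R -> R, profile_ode n f &
          forall s, 0 < s -> derive1 f s = hat_w s,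
        exists f : R -> R,
          [/\ profile_ode n f, forall s, 0 < s -> -1 < derive1 f s < 1
            & derive1 f s @[s --> 0^'+] --> (1 : R)]
      & exists f : R -> R,
          [/\ profile_ode n f, forall s, 0 < s -> -1 < derive1 f s < 1
            & derive1 f s @[s --> 0^'+] --> (-1 : R)]].
Proof.
split.
  case: n hn => [//|m] hn I u I_open I_itv I_pos u_C2 u_sym u_sp u_tr.
  have {}I_pos s : I s -> 0 < s by move=> /I_pos; rewrite /= in_itv/= andbT.
  have [f [uf df f1 d2f]] := symmetric_translator_profile I_open I_pos u_C2 u_sym u_sp u_tr.
  have [g [gP fg]] := slope_extension hn I_itv I_pos df f1 d2f.
  exists g; split=> // p Ip; rewrite /graph uf// fg//; by case: Ip.
(* The bowl is the solution with zero flux at the origin. *)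
have [z [z0 zP]] := reduced_solution_exists n (0 : R) 0.
exists (reduced_slope n z); split.
- exact (bowl_slope_reduced_slope hn zP z0).
- exact (fun f => profile_classification hn zP z0).
- have [f df] := reduced_slope_primitive hn zP.
  exists f; first exact: profile_of_reduced df.
  by move=> s /df/has_derive_derive1.
- by have := profile_exists_cvg hn (oner_neq0 R); rewrite sgr1.
- by have [|f] := @profile_exists_cvg R n hn (-1); rewrite ?oppr_eq0 ?oner_eq0// sgrN1; exists f.
Qed.
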